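(* Let $\mathcal{O}$ be the ring of an algebroid curve with $r$ minimal primes, let $S=S(\mathcal{O})\subset\mathbb{N}^r$ be its semigroup of values, and let $\alpha\in S\setminus\{0\}$. The following conditions are equivalent: (i) $\mathcal{O}$ is Gorenstein; (ii) $S$ is symmetric; (iii) for all $a\in\mathbb{N}^r$: $\ a\in A_\alpha \ \Longrightarrow\ \emptyset\neq F(S,\mathfrak{f}(S)+\alpha-a)\subseteq A_\alpha$.
   Context: $\mathbb{N}$ denotes the non-negative integers. The ring of an algebroid curve is a local, reduced, complete $k$-algebra $\mathcal{O}$ of pure dimension one, finitely generated as a complete $k$-algebra (i.e. a quotient of some $k[[X_1,\dots,X_n]]$), where $k$ is an algebraically closed coefficient field of $\mathcal{O}$. Let $\wp_1,\dots,\wp_r$ be its minimal primes, $I=\{1,\dots,r\}$, $\mathcal{O}_i=\mathcal{O}/\wp_i$, and $\mathcal{K}_i$ the fraction field of $\mathcal{O}_i$. The integral closure of $\mathcal{O}_i$ in $\mathcal{K}_i$ is isomorphic to $k[[t_i]]$, so $\mathcal{K}_i\simeq k((t_i))$ with its normalized valuation $v_i$. Let $\mathcal{K}\simeq\mathcal{K}_1\times\cdots\times\mathcal{K}_r$ be the total ring of fractions of $\mathcal{O}$, $\pi_i:\mathcal{K}\to\mathcal{K}_i$ the projections, $Z(\mathcal{K})$ the set of elements of $\mathcal{K}$ with some zero component, $\widetilde{\mathcal{O}}$ the integral closure of $\mathcal{O}$ in $\mathcal{K}$, and $v:\mathcal{K}\setminus Z(\mathcal{K})\to\mathbb{Z}^r$,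 $v(h)=(v_1(\pi_1(h)),\dots,v_r(\pi_r(h)))$. $\mathcal{O}$ is Gorenstein if $\dim_k\mathcal{O}/\mathcal{C}=\dim_k\widetilde{\mathcal{O}}/\mathcal{O}$, where $\mathcal{C}=\{h\in\mathcal{K}: h\widetilde{\mathcal{O}}\subset\mathcal{O}\}$. The semigroup of values is $S=v(\mathcal{O}\setminus Z(\mathcal{K}))$. $\mathbb{Z}^r$ has the componentwise order $\le$. The conductor $c(S)$ is the unique least $\gamma\in S$ with $\gamma+\mathbb{N}^r\subset S$, and $\mathfrak{f}(S)=c(S)-(1,\dots,1)$. For $\alpha\in\mathbb{Z}^r$ and $i\in I$ let $F_i(\alpha)=\{\beta\in\mathbb{Z}^r:\beta_i=\alpha_i,\ \beta_j>\alpha_j\ \forall j\neq i\}$, $F(\alpha)=\bigcup_{i=1}^rF_i(\alpha)$, and $F(S,\alpha)=F(\alpha)\cap S$. $S$ is called symmetric if for all $\alpha\in\mathbb{N}^r$: $\alpha\in S\Longleftrightarrow F(S,\mathfrak{f}(S)-\alpha)=\emptyset$. For $\alpha\in S\setminus\{0\}$, the Apéry set is $A_\alpha=\{\beta\in S:\beta-\alpha\notin S\}$. *)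

(* Defs.v *)
From HB Require Import structures.
From mathcomp Require Import all_boot all_order all_algebra.
From mathcomp Require Import ring_quotient fraction mxpoly.
From mathcomp Require Import boolp classical_sets.
From mathcomp Require Import mpoly.

Set Implicit Arguments.
Unset Strict Implicit.
Unset Printing Implicit Defensive.

Import Order.TTheory GRing.Theory Num.Theory.
Local Open Scope quotient_scope.
Local Open Scope ring_scope.
Local Open Scope classical_set_scope.

(* A series is its coefficient function on the exponents. *)
Definition mpseries (n : nat) (k : comNzRingType) : Type := 'X_{1..n} -> k.

Section PowerSeries.
Variables (n : nat) (k : comNzRingType).
Local Notation ps := (mpseries n k).
Implicit Types (f g h : ps) (m : 'X_{1..n}) (c : k).

HB.instance Definition _ := gen_eqMixin ps.
HB.instance Definition _ := gen_choiceMixin ps.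

Definition mps_add f g : ps := fun m => f m + g m.
Definition mps_opp f : ps := fun m => - f m.
Definition mps_const c : ps := fun m => if m == 0%MM then c else 0.
Definition mps_scale c f : ps := fun m => c * f m.
(* Cauchy product; the bound on the degrees only serves to make the index
   type finite. *)
Definition mps_mul f g : ps := fun m =>
  \sum_(d : 'X_{1..n < (mdeg m).+1, (mdeg m).+1} | m == (d.1 + d.2)%MM)
     f d.1 * g d.2.

Let addA : associative mps_add.
Proof. by move=> f g h; apply/funext=> m; rewrite /mps_add addrA. Qed.
Let addC : commutative mps_add.
Proof. by move=> f g; apply/funext=> m; rewrite /mps_add addrC. Qed.
Let add0 : left_id (mps_const 0) mps_add.
Proof.
by move=> f; apply/funext=> m; rewrite /mps_add /mps_const if_same add0r.
Qed.
Let addN : left_inverse (mps_const 0) mps_opp mps_add.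
Proof.
by move=> f; apply/funext=> m; rewrite /mps_add /mps_const if_same addNr.
Qed.

HB.instance Definition _ := GRing.isZmodule.Build ps addA addC add0 addN.

(* The ring axioms are read off from those of {mpoly k[n]} by truncation. *)
Let trunc b f : {mpoly k[n]} := \sum_(m : 'X_{1..n < b}) f m *: 'X_[m].

Let truncE b f m : (mdeg m < b)%N -> (trunc b f)@_m = f m.
Proof. by move=> lt_mb; rewrite /trunc mcoeff_mpoly. Qed.

Let mul_mcoeff f g (p q : {mpoly k[n]}) m :
    (forall d, (mdeg d <= mdeg m)%N -> p@_d = f d) ->
    (forall d, (mdeg d <= mdeg m)%N -> q@_d = g d) ->
  mps_mul f g m = (p * q)@_m.
Proof.
move=> pf qg; rewrite mcoeffM; apply: eq_bigr => d _.
by rewrite pf ?qg // -ltnS bmdeg.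
Qed.

Let mul_trunc b f g m : (mdeg m < b)%N ->
  mps_mul f g m = (trunc b f * trunc b g)@_m.
Proof.
by move=> lt_mb; apply: mul_mcoeff => d le_dm; apply/truncE/(leq_ltn_trans le_dm).
Qed.

Let mulA : associative mps_mul.
Proof.
move=> f g h; apply/funext=> m; pose T := trunc (mdeg m).+1.
rewrite (@mul_mcoeff _ _ (T f) (T g * T h)); first last.
- by move=> d le_dm; rewrite (@mul_trunc (mdeg m).+1).
- by move=> d le_dm; rewrite truncE.
rewrite (@mul_mcoeff _ _ (T f * T g) (T h)) ?mulrA //.
- by move=> d le_dm; rewrite (@mul_trunc (mdeg m).+1).
- by move=> d le_dm; rewrite truncE.
Qed.
Let mulC : commutative mps_mul.
Proof.
by move=> f g; apply/funext=> m; rewrite !(@mul_trunc (mdeg m).+1) // mulrC.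
Qed.
Let mul1 : left_id (mps_const 1) mps_mul.
Proof.
move=> f; apply/funext=> m.
rewrite (@mul_mcoeff _ _ 1 (trunc (mdeg m).+1 f)) ?mul1r ?truncE //.
- by move=> d _; rewrite mcoeff1 /mps_const; case: eqP.
- by move=> d le_dm; rewrite truncE.
Qed.
Let mulDl : left_distributive mps_mul mps_add.
Proof.
move=> f g h; apply/funext=> m; rewrite /mps_mul /mps_add -big_split /=.
by apply: eq_bigr => d _; rewrite mulrDl.
Qed.
Let one_neq0 : mps_const 1 != 0.
Proof.
apply/eqP => /(congr1 (fun f : ps => f 0%MM)).
by rewrite /GRing.zero /= /mps_const eqxx => /eqP; rewrite oner_eq0.
Qed.

HB.instance Definition _ :=
  GRing.Zmodule_isComNzRing.Build ps mulA mulC mul1 mulDl one_neq0.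

Let scaleA a b f : mps_scale a (mps_scale b f) = mps_scale (a * b) f.
Proof. by apply/funext=> m; rewrite /mps_scale mulrA. Qed.
Let scale1 : left_id 1 mps_scale.
Proof. by move=> f; apply/funext=> m; rewrite /mps_scale mul1r. Qed.
Let scaleDr : right_distributive mps_scale +%R.
Proof. by move=> c f g; apply/funext=> m; exact: mulrDr. Qed.
Let scaleDl f : {morph mps_scale^~ f : a b / a + b}.
Proof. by move=> a b; apply/funext=> m; exact: mulrDl. Qed.

HB.instance Definition _ :=
  GRing.Zmodule_isLmodule.Build k ps scaleA scale1 scaleDr scaleDl.

Let scaleAl c f g : c *: (f * g) = (c *: f) * g.
Proof.
apply/funext=> m; rewrite /GRing.scale /GRing.mul /= /mps_scale /mps_mul.
by rewrite mulr_sumr; apply: eq_bigr => d _; rewrite mulrA.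
Qed.

HB.instance Definition _ := GRing.Lmodule_isLalgebra.Build k ps scaleAl.
HB.instance Definition _ := GRing.Lalgebra_isComAlgebra.Build k ps.

Definition order_eq f (d : nat) : Prop :=
  (forall m, (mdeg m < d)%N -> f m = 0) /\
  (exists2 m, mdeg m = d & f m != 0).

End PowerSeries.

Section Primes.
Variable R : comNzRingType.
Implicit Types p q : prime_idealr R.

Definition minimal_prime p : Prop :=
  forall q, {subset q <= p} -> {subset p <= q}.

Definition prime_chain (n : nat) (c : 'I_n.+1 -> prime_idealr R) : Prop :=
  forall i j : 'I_n.+1, (i < j)%N ->
    {subset c i <= c j} /\ ~ {subset c j <= c i}.

Definition krull_dim_eq (d : nat) : Prop :=
  (exists c, @prime_chain d c) /\ (forall n c, @prime_chain n c -> (n <= d)%N).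

Definition reduced_ring : Prop := forall (x : R) n, x ^+ n = 0 -> x = 0.

(* The enumeration is without repetition; prime ideals are boolean predicates and
   are compared extensionally. *)
Definition minimal_primes (r : nat) (P : 'I_r -> prime_idealr R) : Prop :=
  [/\ forall i, minimal_prime (P i),
      forall i j, P i =i P j -> i = j
    & forall q, minimal_prime q -> exists i, q =i P i].

End Primes.

(* R/p; ring_quotient gives {ideal_quot p} its commutative ring structure, the
   rest of the idomainType structure (with classically chosen inverses of the
   units) is added here. *)
Definition branch (R : comNzRingType) (p : prime_idealr R) : Type :=
  {ideal_quot p}.

Section Branch.
Variables (R : comNzRingType) (p : prime_idealr R).
Local Notation B := (branch p).

HB.instance Definition _ := GRing.ComNzRing.copy B {ideal_quot p}.

Let unitB : pred B := fun x => `[< exists y, y * x = 1 >].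
Let invB (x : B) : B := xget x [set y | y * x = 1].

Let mulVB : {in unitB, left_inverse 1 invB *%R}.
Proof.
by move=> x /asboolP; exact: (@xgetPex _ x [set y | y * x = 1]).
Qed.
Let unitBP : forall x y, y * x = 1 -> unitB x.
Proof. by move=> x y yx1; apply/asboolP; exists y. Qed.
Let invB_out : {in [predC unitB], invB =1 id}.
Proof.
move=> x /asboolPn nUx; apply: xgetPN => y yx1.
by apply: nUx; exists y.
Qed.

HB.instance Definition _ :=
  GRing.ComNzRing_hasMulInverse.Build B mulVB unitBP invB_out.

Let idomB : GRing.integral_domain_axiom B.
Proof. exact: Quotient.rquot_IdomainAxiom. Qed.

HB.instance Definition _ := GRing.ComUnitRing_isIntegral.Build B idomB.

Definition to_branch (x : R) : B := \pi_{ideal_quot p} x.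

Let to_branch_zmod : zmod_morphism to_branch.
Proof. exact: (rmorphB (\pi_{ideal_quot p})). Qed.
Let to_branch_monoid : monoid_morphism to_branch.
Proof. by split; [exact: rmorph1 | exact: rmorphM]. Qed.

HB.instance Definition _ := GRing.isZmodMorphism.Build R B to_branch to_branch_zmod.
HB.instance Definition _ :=
  GRing.isMonoidMorphism.Build R B to_branch to_branch_monoid.

End Branch.

(* A k-algebra quotient of some k[[X_1, ..., X_n]]; a nonzero such quotient is
   local and complete, with coefficient field k. *)
Definition complete_fg (k : comNzRingType) (O : comAlgType k) : Prop :=
  exists n (f : {lrmorphism mpseries n k -> O}), forall y, exists x, f x = y.

Definition algebroid_curve (k : closedFieldType) (O : comAlgType k) : Prop :=
  [/\ complete_fg O, reduced_ring O
    & forall p : prime_idealr O, minimal_prime p ->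
        krull_dim_eq (branch p) 1].

Definition branch_frac (R : comNzRingType) (p : prime_idealr R) : fieldType :=
  {fraction (branch p)}.

Definition to_branch_frac (R : comNzRingType) (p : prime_idealr R) (x : R) :
    branch_frac p :=
  FracField.tofrac (to_branch p x).

(* phi identifies k[[t]] with the integral closure of O/p in its fraction field,
   as k-algebras; t is the unique variable of mpseries 1 k. *)
Definition normalization (k : fieldType) (O : comAlgType k)
    (p : prime_idealr O) (phi : {rmorphism mpseries 1 k -> branch_frac p}) :
    Prop :=
  [/\ injective phi,
      forall c : k, phi c%:A = to_branch_frac p c%:A
    & forall h : branch_frac p,
        integralOver (@FracField.tofrac (branch p)) h <-> exists f, phi f = h].

(* For K the fraction field of phi(k[[t]]), i.e. K = k((t)): h is nonzero and its
   t-adic order is z. *)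
Definition value_eq (k K : fieldType) (phi : mpseries 1 k -> K) (h : K)
    (z : int) : Prop :=
  exists f g (a b : nat),
    [/\ order_eq f a, order_eq g b, h * phi g = phi f & z = a%:Z - b%:Z].

(* The total ring of fractions of O, in its description as the product of the
   fields K_i = Frac(O/P_i). *)
Definition totfrac (k : fieldType) (O : comAlgType k) (r : nat)
    (P : 'I_r -> prime_idealr O) : Type := forall i : 'I_r, branch_frac (P i).

Section TotalFractions.
Variables (k : fieldType) (O : comAlgType k) (r : nat).
Variable P : 'I_r -> prime_idealr O.
Local Notation K := (totfrac P).

HB.instance Definition _ := gen_eqMixin K.
HB.instance Definition _ := gen_choiceMixin K.

Definition to_totfrac (x : O) : K := fun i => to_branch_frac (P i) x.

Definition tf_zero : K := fun=> 0.
Definition tf_one : K := fun=> 1.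
Definition tf_add (f g : K) : K := fun i => f i + g i.
Definition tf_opp (f : K) : K := fun i => - f i.
Definition tf_mul (f g : K) : K := fun i => f i * g i.
Definition tf_scale (c : k) (f : K) : K := tf_mul (to_totfrac c%:A) f.

Let tfP (f g : K) : (forall i, f i = g i) -> f = g.
Proof. by move=> fg; apply: functional_extensionality_dep. Qed.

Let addA : associative tf_add.
Proof. by move=> f g h; apply: tfP => i; apply: addrA. Qed.
Let addC : commutative tf_add.
Proof. by move=> f g; apply: tfP => i; apply: addrC. Qed.
Let add0 : left_id tf_zero tf_add.
Proof. by move=> f; apply: tfP => i; apply: add0r. Qed.
Let addN : left_inverse tf_zero tf_opp tf_add.
Proof. by move=> f; apply: tfP => i; apply: addNr. Qed.

HB.instance Definition _ := GRing.isZmodule.Build K addA addC add0 addN.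

Let mulA : associative tf_mul.
Proof. by move=> f g h; apply: tfP => i; apply: mulrA. Qed.
Let mulC : commutative tf_mul.
Proof. by move=> f g; apply: tfP => i; apply: mulrC. Qed.
Let mul1 : left_id tf_one tf_mul.
Proof. by move=> f; apply: tfP => i; apply: mul1r. Qed.
Let mulDl : left_distributive tf_mul tf_add.
Proof. by move=> f g h; apply: tfP => i; apply: mulrDl. Qed.

(* Only possibly-zero (pz), since r is arbitrary. *)
HB.instance Definition _ :=
  GRing.Zmodule_isComPzRing.Build K mulA mulC mul1 mulDl.

Let scaleA a b f : tf_scale a (tf_scale b f) = tf_scale (a * b) f.
Proof.
apply: tfP => i; rewrite /tf_scale /tf_mul /to_totfrac /to_branch_frac mulrA.
by rewrite -!rmorphM /= -scalerAl mul1r scalerA.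
Qed.
Let scale1 : left_id 1 tf_scale.
Proof.
move=> f; apply: tfP => i; rewrite /tf_scale /tf_mul /to_totfrac.
by rewrite /to_branch_frac scale1r !rmorph1 mul1r.
Qed.
Let scaleDr : right_distributive tf_scale +%R.
Proof. by move=> c f g; apply: tfP => i; apply: mulrDr. Qed.
Let scaleDl f : {morph tf_scale^~ f : a b / a + b}.
Proof.
move=> a b; apply: tfP => i; rewrite /tf_scale /tf_mul /to_totfrac.
by rewrite /to_branch_frac scalerDl !rmorphD mulrDl.
Qed.

HB.instance Definition _ :=
  GRing.Zmodule_isLmodule.Build k K scaleA scale1 scaleDr scaleDl.

Definition image_ring : set K := range to_totfrac.

(* The polynomial evaluation is written out because K, being only a
   comPzRingType, does not support integralOver. *)
Definition integral_closure : set K :=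
  [set h | exists2 p : {poly O}, p \is monic
             & \sum_(j < size p) to_totfrac p`_j * h ^+ j = 0].

Definition conductor_ideal : set K :=
  [set h | forall g, integral_closure g -> image_ring (h * g)].

End TotalFractions.

Arguments image_ring {k O r} P.
Arguments integral_closure {k O r} P.
Arguments conductor_ideal {k O r} P.

(* For subspaces B <= A of V: dim_k A/B = d, witnessed by a basis of A/B. *)
Definition quot_dim_eq (k : fieldType) (V : lmodType k) (A B : set V) (d : nat) :
    Prop :=
  exists2 e : 'I_d -> V, (forall j, A (e j))
    & forall h, A h ->
        exists! c : {ffun 'I_d -> k}, B (h - \sum_j c j *: e j).

(* Both dimensions are finite for an algebroid curve. *)
Definition gorenstein (k : fieldType) (O : comAlgType k) (r : nat)
    (P : 'I_r -> prime_idealr O) : Prop :=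
  exists d, quot_dim_eq (image_ring P) (conductor_ideal P) d /\
            quot_dim_eq (integral_closure P) (image_ring P) d.

Definition value_semigroup (k : fieldType) (O : comAlgType k) (r : nat)
    (P : 'I_r -> prime_idealr O)
    (phi : forall i, {rmorphism mpseries 1 k -> branch_frac (P i)}) :
    set {ffun 'I_r -> int} :=
  [set a | exists x : O, forall i, value_eq (phi i) (to_totfrac P x i) (a i)].

Section Combinatorics.
Variable r : nat.
Local Notation Zr := {ffun 'I_r -> int}.
Implicit Types (S : set Zr) (a b c : Zr).

Definition cw_le a b : Prop := forall i, a i <= b i.

Definition natural a : Prop := cw_le 0 a.

Definition conductor_candidates S : set Zr :=
  [set c | S c /\ forall a, natural a -> S (c + a)].

(* The least candidate; the default value 0 of xget is never used for the
   semigroup of values of an algebroid curve. *)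
Definition conductor S : Zr :=
  xget 0 [set c | conductor_candidates S c /\
                  forall d, conductor_candidates S d -> cw_le c d].

Definition frobenius S : Zr := [ffun i => conductor S i - 1].

Definition Fi (i : 'I_r) a : set Zr :=
  [set b | b i = a i /\ forall j, j != i -> a j < b j].

Definition F a : set Zr := \bigcup_(i : 'I_r) Fi i a.

Definition FS S a : set Zr := F a `&` S.

Definition symmetric_semigroup S : Prop :=
  forall a, natural a -> (S a <-> FS S (frobenius S - a) = set0).

Definition apery S a : set Zr := [set b | S b /\ ~ S (b - a)].

End Combinatorics.

(* Main.v *)
Require Import Defs.
From HB Require Import structures.
From mathcomp Require Import all_boot all_order all_algebra.
From mathcomp Require Import ring_quotient fraction mxpoly.
From mathcomp Require Import boolp classical_sets.
From mathcomp Require Import mpoly zify.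

Set Implicit Arguments.
Unset Strict Implicit.
Unset Printing Implicit Defensive.

Import Order.TTheory GRing.Theory Num.Theory.
Local Open Scope ring_scope.
Local Open Scope classical_set_scope.

(** Along the normalizations the image A of the ring in its total
    ring of fractions becomes a subalgebra of the product W of r copies of k[[t]], and W
    becomes the integral closure.

    The product of the ideals t^N k[[t]] lies in A for large N: if x in A has positive order e
    on one branch, then 1, t, ..., t^(e-1) generate k[[t]] over k[[x]], by Weierstrass
    division, and k[[x]] is contained in the image of A because A is complete; as k[[t]]
    has the same fractions as that image, a common denominator of the generators conducts
    k[[t]] into it ([common_denominator]), and multiplying by an element that vanishes on the
    other branches only brings this into A ([branches_conductor]).  Hence there is a
    least vector c such that every series of order at least c lies in A, and it is the
    conductor of the semigroup S ([conductor_value_set]).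

    Walk from 0 to c by unit steps.  At a step from a to a + e_i, the filtration of A by
    the order drops by one dimension if some x in A satisfies v(x) >= a and v_i(x) = a_i
    (the step is hit), and otherwise that of W / A does.  So dim A / C counts the
    steps that are hit and dim W / A those that are missed.  Reflection in c turns a step
    at a into a step at c - a - e_i of a path walked backwards; two steps that
    correspond cannot both be hit, since the product of the witnesses would have order
    c_i - 1 at i and at least c_j elsewhere ([no_frobenius]).  As the number of hit
    steps does not depend on the path, the ring is Gorenstein if and only if, of two
    corresponding steps, one is always hit ([gorenstein_complementary]).

    A hit on the reflected step says that F_i(S, f - a) is not empty.  If one of two
    corresponding steps is always hit, then a vector a for which all F_i(S, f - a) are
    empty is hit in every direction, and a generic combination of the witnesses has
    order exactly a, which gives symmetry.  The converse is [symmetric_complementary].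

    The equivalence of symmetry with the condition on the Apery set rests on S being a
    semigroup of natural vectors with a conductor, on F(S, f) being empty, and on
    alpha being positive in every component, the last because A is local ([symmetric_apery]). *)

(** * Dimensions of quotients *)

Section QuotientDimension.
Variables (k : fieldType) (V : lmodType k).
Implicit Types A B C : set V.

Definition subspace A : Prop :=
  A 0 /\ forall (c : k) x y, A x -> A y -> A (c *: x + y).

Lemma subspaceD A x y : subspace A -> A x -> A y -> A (x + y).
Proof. by move=> [_ hA] Ax Ay; rewrite -[x]scale1r; apply: hA. Qed.

Lemma subspaceZ A c x : subspace A -> A x -> A (c *: x).
Proof. by move=> [A0 hA] Ax; rewrite -[_ *: _]addr0; apply: hA. Qed.

Lemma subspaceB A x y : subspace A -> A x -> A y -> A (x - y).
Proof.
by move=> sA Ax Ay; apply: subspaceD => //; rewrite -scaleN1r; apply: subspaceZ.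
Qed.

Lemma subspace_sum A (I : Type) (s : seq I) (Q : pred I) (F : I -> V) :
  subspace A -> (forall i, Q i -> A (F i)) -> A (\sum_(i <- s | Q i) F i).
Proof.
move=> sA AF; elim/big_ind: _ => //; first by case: sA.
by move=> x y; apply: subspaceD.
Qed.

Lemma quot_dim_refl A : subspace A -> quot_dim_eq A A 0.
Proof.
move=> sA; exists (fun=> 0) => [[]//|h Ah].
exists [ffun=> 0]; split; first by rewrite big_ord0 subr0.
by move=> c' _; apply/ffunP; case.
Qed.

Lemma quot_dim_step A B C d w :
    subspace B -> subspace C -> C `<=` B ->
    A w -> ~ B w -> B `<=` A ->
    (forall x, A x -> exists c : k, B (x - c *: w)) ->
  quot_dim_eq B C d -> quot_dim_eq A C d.+1.
Proof.
move=> sB sC CB Aw nBw BA AB [e Be eP].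
pose e' (j : 'I_d.+1) := if unlift ord0 j is Some j' then e j' else w.
have e'0 : e' ord0 = w by rewrite /e' unlift_none.
have e'S j : e' (lift ord0 j) = e j by rewrite /e' liftK.
exists e' => [j|h Ah].
  by rewrite /e'; case: unliftP => // j' _; apply/BA/Be.
have [c0 Bc0] := AB h Ah.
have [c [Cc cU]] := eP _ Bc0.
pose c' : {ffun 'I_d.+1 -> k} :=
  [ffun j => if unlift ord0 j is Some j' then c j' else c0].
have sumE (u : {ffun 'I_d.+1 -> k}) :
    \sum_j u j *: e' j = u ord0 *: w + \sum_j u (lift ord0 j) *: e j.
  by rewrite big_ord_recl e'0; congr (_ + _); apply: eq_bigr => j _; rewrite e'S.
exists c'; split.
  rewrite sumE opprD addrA /c' ffunE unlift_none.
  by under eq_bigr => j _ do rewrite ffunE liftK.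
move=> u; rewrite sumE opprD addrA => Cu.
have Bs (v : 'I_d -> k) : B (\sum_j v j *: e j).
  by apply: subspace_sum => // j _; apply: subspaceZ.
have u0 : u ord0 = c0.
  apply: contrapT => /eqP; rewrite -subr_eq0 => ne.
  apply: nBw; have /(subspaceZ (u ord0 - c0)^-1 sB) :
    B ((u ord0 - c0) *: w).
    rewrite (_ : _ *: w = (h - c0 *: w) - (h - u ord0 *: w)); last first.
      by rewrite scalerBl opprB [RHS]addrC addrA subrK.
    apply: subspaceB => //; rewrite -[X in B X](subrK (\sum_j u (lift ord0 j) *: e j)).
    by apply: subspaceD => //; apply: CB.
  by rewrite scalerA mulVf // scale1r.
have := cU [ffun j => u (lift ord0 j)].
rewrite u0 in Cu.
move=> /(_ _)/ffunP cE; apply/ffunP => j; rewrite ffunE.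
case: unliftP => [j'|] -> //; rewrite cE ?ffunE //.
by under eq_bigr => i _ do rewrite ffunE.
Qed.

(** The matrices that express two bases of A / B in each other are inverse to each
    other. *)
Lemma quot_dim_leq A B d d' : subspace B ->
  quot_dim_eq A B d -> quot_dim_eq A B d' -> (d <= d')%N.
Proof.
move=> sB [e Ae eP] [e' Ae' eP'].
have /boolp.choice[M MP] j : exists c : {ffun 'I_d' -> k},
    B (e j - \sum_l c l *: e' l).
  by have [c [Bc _]] := eP' _ (Ae j); exists c.
have /boolp.choice[N NP] j : exists c : {ffun 'I_d -> k},
    B (e' j - \sum_l c l *: e l).
  by have [c [Bc _]] := eP _ (Ae' j); exists c.
apply: (@mulmx1_min _ d d' (\matrix_(i, j) M i j) (\matrix_(i, j) N i j)).
apply/matrixP => i j; rewrite !mxE.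
have [c [_ cU]] := eP _ (Ae i).
have Bi : B (e i - \sum_l [ffun l => \sum_m M i m * N m l] l *: e l).
  have -> : e i - \sum_l [ffun l => \sum_m M i m * N m l] l *: e l =
     (e i - \sum_m M i m *: e' m) +
     \sum_m M i m *: (e' m - \sum_l N m l *: e l).
    under [X in _ = _ + X]eq_bigr => m _ do rewrite scalerBr.
    rewrite sumrB addrA subrK; congr (_ - _).
    under eq_bigr => l _ do rewrite ffunE scaler_suml.
    rewrite exchange_big; apply: eq_bigr => m _; rewrite scaler_sumr.
    by apply: eq_bigr => l _; rewrite scalerA.
  apply: subspaceD => //; apply: subspace_sum => // m _; exact: subspaceZ.
have Bi' : B (e i - \sum_l [ffun l => (i == l)%:R] l *: e l).
  rewrite (bigD1 i) //= ffunE eqxx scale1r opprD addrA subrr sub0r.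
  rewrite big1 ?oppr0; last first.
    by move=> l li; rewrite ffunE eq_sym (negbTE li) scale0r.
  by case: sB.
have /ffunP/(_ j) := etrans (esym (cU _ Bi)) (cU _ Bi').
rewrite !ffunE => <-; apply: eq_bigr => m _; by rewrite !mxE.
Qed.

Lemma quot_dim_uniq A B d d' : subspace B ->
  quot_dim_eq A B d -> quot_dim_eq A B d' -> d = d'.
Proof.
by move=> sB Ad Ad'; apply/eqP; rewrite eqn_leq !(quot_dim_leq sB Ad Ad', quot_dim_leq sB Ad' Ad).
Qed.

End QuotientDimension.

Lemma quot_dim_image (k : fieldType) (V W : lmodType k) (f : {linear V -> W})
    (A B : set V) d : injective f -> 
  quot_dim_eq (f @` A) (f @` B) d <-> quot_dim_eq A B d.
Proof.
move=> finj.
have imE (C : set V) x : (f @` C) (f x) <-> C x.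
  by split=> [[y Cy /finj <-]|Cx]; [|exists x].
have sumE d' (c : 'I_d' -> k) e : \sum_j c j *: f (e j) = f (\sum_j c j *: e j).
  by rewrite linear_sum; apply: eq_bigr => j _; rewrite linearZ.
split=> [[e Ae eP]|[e Ae eP]].
  have /boolp.choice[e' e'P] j : exists x, A x /\ f x = e j.
    by have [x Ax xe] := Ae j; exists x.
  have eE : e = f \o e' by apply/funext => j /=; case: (e'P j).
  rewrite {e}eE in eP Ae e'P.
  exists e' => [j|h Ah]; first by case: (e'P j).
  have [c [Bc cU]] := eP (f h) ((imE _ _).2 Ah).
  exists c; split; first by move: Bc; rewrite sumE -linearB imE.
  by move=> c' Bc'; apply: cU; rewrite sumE -linearB imE.
exists (f \o e) => [j|_ [h Ah <-]]; first exact/imE.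
have [c [Bc cU]] := eP h Ah; exists c; split; first by rewrite sumE -linearB imE.
by move=> c'; rewrite sumE -linearB imE; apply: cU.
Qed.

(** * Power series in one variable *)

Section Univariate.
Variable k : fieldType.
Local Notation ps := (mpseries 1 k).
Implicit Types (f g u w : ps) (a b d : nat).

Definition mon d : 'X_{1..1} := [multinom d | _ < 1].

Lemma mdeg_mon d : mdeg (mon d) = d.
Proof. by rewrite mdegE big_ord1 mnmE. Qed.

Lemma monK (m : 'X_{1..1}) : mon (mdeg m) = m.
Proof. by apply/mnmP => i; rewrite mdegE big_ord1 mnmE (ord1 i). Qed.

Lemma monD a b : (mon a + mon b)%MM = mon (a + b).
Proof. by rewrite -[LHS]monK mdegD !mdeg_mon. Qed.

Definition tcoef f d : k := f (mon d).

Lemma tcoefP f g : tcoef f =1 tcoef g -> f = g.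
Proof. by move=> fg; apply/funext => m; rewrite -(monK m); apply: fg. Qed.

Lemma tcoef0 d : tcoef 0 d = 0.
Proof. by rewrite /tcoef /GRing.zero /= /mps_const if_same. Qed.

Lemma tcoefD f g d : tcoef (f + g) d = tcoef f d + tcoef g d.
Proof. by []. Qed.

Lemma tcoefN f d : tcoef (- f) d = - tcoef f d.
Proof. by []. Qed.

Lemma tcoefZ (c : k) f d : tcoef (c *: f) d = c * tcoef f d.
Proof. by []. Qed.

Lemma tcoef1 d : tcoef 1 d = (d == 0)%:R.
Proof.
rewrite /tcoef /GRing.one /= /mps_const -mdeg_eq0 mdeg_mon.
by case: (d == 0).
Qed.

Lemma tcoefM f g d : tcoef (f * g) d = \sum_(i < d.+1) tcoef f i * tcoef g (d - i).
Proof.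
rewrite /tcoef {1}/GRing.mul /= /mps_mul mdeg_mon.
have lt_mon (i : 'I_d.+1) : (mdeg (mon i) < d.+1)%N by rewrite mdeg_mon.
have lt_mon' (i : 'I_d.+1) : (mdeg (mon (d - i)) < d.+1)%N.
  by rewrite mdeg_mon ltnS leq_subr.
pose h (i : 'I_d.+1) : 'X_{1..1 < d.+1, d.+1} :=
  (BMultinom (lt_mon i), BMultinom (lt_mon' i)).
pose h' (p : 'X_{1..1 < d.+1, d.+1}) : 'I_d.+1 := Ordinal (bmdeg p.1).
rewrite (reindex_onto h h') /= => [|[m1 m2] /eqP dE]; last first.
  have := congr1 (@mdeg _) dE; rewrite mdegD mdeg_mon /= => dE'.
  rewrite /h; congr pair; apply/val_inj => /=; first exact: monK.
  by rewrite (_ : d - _ = mdeg m2)%N ?monK //; lia.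
apply: eq_bigl => i; rewrite monD subnKC ?eqxx -1?ltnS //=.
by apply/eqP/val_inj; rewrite /= mdeg_mon.
Qed.

Definition vanish f d : Prop := forall i, (i < d)%N -> tcoef f i = 0.

Lemma vanish_weak f a b : (b <= a)%N -> vanish f a -> vanish f b.
Proof. by move=> ba fa i ib; apply/fa/(leq_trans ib). Qed.

Lemma vanish0 d : vanish 0 d.
Proof. by move=> i _; exact: tcoef0. Qed.

Lemma vanishD f g d : vanish f d -> vanish g d -> vanish (f + g) d.
Proof. by move=> fd gd i id; rewrite tcoefD fd ?gd ?addr0. Qed.

Lemma vanishZ (c : k) f d : vanish f d -> vanish (c *: f) d.
Proof. by move=> fd i id; rewrite tcoefZ fd ?mulr0. Qed.

Lemma vanishB f g d : vanish f d -> vanish g d -> vanish (f - g) d.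
Proof. by move=> fd gd i id; rewrite tcoefD tcoefN fd ?gd ?subr0. Qed.

Lemma vanishS f d : vanish f d -> tcoef f d = 0 -> vanish f d.+1.
Proof.
by move=> fd f0 i; rewrite ltnS leq_eqVlt => /predU1P[->//|]; apply: fd.
Qed.

Lemma vanishM f g a b : vanish f a -> vanish g b -> vanish (f * g) (a + b).
Proof.
move=> fa gb i iab; rewrite tcoefM big1 // => j _.
have [ja|ja] := ltnP j a; first by rewrite fa ?mul0r.
by rewrite gb ?mulr0 //; have := ltn_ord j; lia.
Qed.

Lemma vanishMl f g b : vanish g b -> vanish (f * g) b.
Proof. by move=> gb; rewrite -[b]add0n; apply: vanishM. Qed.

Lemma tcoefM_lead f g a b : vanish f a -> vanish g b ->
  tcoef (f * g) (a + b) = tcoef f a * tcoef g b.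
Proof.
move=> fa gb; rewrite tcoefM.
have lt_a : (a < (a + b).+1)%N by lia.
rewrite (bigD1 (Ordinal lt_a)) //= addKn big1 ?addr0 // => j.
rewrite -val_eqE /= => ja.
have [ja'|ja'] := ltnP j a; first by rewrite fa ?mul0r.
by rewrite gb ?mulr0 //; have := ltn_ord j; lia.
Qed.

Definition has_order f d : Prop := vanish f d /\ tcoef f d <> 0.

Lemma has_order_uniq f a b : has_order f a -> has_order f b -> a = b.
Proof.
by move=> [fa a0] [fb b0]; case: (ltngtP a b) => // [/fb|/fa].
Qed.

Lemma has_order_neq0 f a : has_order f a -> f <> 0.
Proof. by move=> [_ +] f0; rewrite f0 tcoef0. Qed.

Lemma has_orderM f g a b :
  has_order f a -> has_order g b -> has_order (f * g) (a + b).
Proof.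
move=> [fa a0] [gb b0]; split; first exact: vanishM.
by rewrite tcoefM_lead //; apply/eqP; rewrite mulf_neq0 //; apply/eqP.
Qed.

Lemma has_order1 : has_order 1 0.
Proof. by split=> //; rewrite tcoef1; apply/eqP; rewrite oner_neq0. Qed.

Lemma has_order_ex f : f <> 0 -> exists d, has_order f d.
Proof.
move=> f0; have : exists d, tcoef f d != 0.
  apply: contrapT => nf; apply: f0; apply: tcoefP => d; rewrite tcoef0.
  by apply: contrapT => /eqP fd; apply: nf; exists d.
move=> /ex_minnP[d fd dmin]; exists d; split; last exact/eqP.
move=> i id; apply/eqP; apply: contraTT id => /dmin; by rewrite -leqNgt.
Qed.

Lemma vanish_has_order f d a : vanish f d -> has_order f a -> (d <= a)%N.
Proof. by move=> fd [_ a0]; rewrite leqNgt; apply/negP => /fd. Qed.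

Lemma order_eqE f d : order_eq f d <-> has_order f d.
Proof.
split=> [[fd [m md fm]]|[fd f0]]; split.
- by move=> i id; apply: fd; rewrite mdeg_mon.
- by apply/eqP; rewrite /tcoef -md monK.
- by move=> m md; rewrite -(monK m); apply: fd.
- by exists (mon d); rewrite ?mdeg_mon //; apply/eqP.
Qed.

Definition tpow a : ps := fun m => (mdeg m == a)%:R.

Definition shift a f : ps := fun m => tcoef f (mdeg m + a).

Lemma tcoef_tpow a d : tcoef (tpow a) d = (d == a)%:R.
Proof. by rewrite /tcoef /tpow mdeg_mon. Qed.

Lemma tcoef_shift a f d : tcoef (shift a f) d = tcoef f (d + a).
Proof. by rewrite /tcoef /shift mdeg_mon. Qed.

Lemma has_order_tpow a : has_order (tpow a) a.
Proof.
split=> [i ia|]; rewrite tcoef_tpow ?eqxx ?(ltn_eqF ia) //.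
by apply/eqP; rewrite oner_neq0.
Qed.

Lemma tcoef_tpowM a f d :
  tcoef (tpow a * f) d = if (a <= d)%N then tcoef f (d - a) else 0.
Proof.
rewrite tcoefM; case: leqP => ad; last first.
  by rewrite big1 // => i _; rewrite tcoef_tpow ltn_eqF ?mul0r //; have := ltn_ord i; lia.
have lt_a : (a < d.+1)%N by lia.
rewrite (bigD1 (Ordinal lt_a)) //= tcoef_tpow eqxx mul1r big1 ?addr0 // => i.
by rewrite -val_eqE tcoef_tpow /= => /negbTE->; rewrite mul0r.
Qed.

Lemma vanish_shiftE a f : vanish f a -> f = tpow a * shift a f.
Proof.
move=> fa; apply: tcoefP => d; rewrite tcoef_tpowM tcoef_shift.
by case: leqP => [ad|/fa//]; rewrite subnK.
Qed.

Lemma series_eq_vanish f g : (forall n, vanish (f - g) n) -> f = g.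
Proof.
move=> fg; apply: tcoefP => d; apply/eqP; rewrite -subr_eq0.
by rewrite -tcoefN -tcoefD (fg d.+1).
Qed.

End Univariate.

(** * Substitution into a univariate series *)

Section Substitution.
Variables (n : nat) (k : fieldType).
Local Notation ps := (mpseries n k).
Implicit Types (y z : ps) (g : nat -> k) (m : 'X_{1..n}).

Lemma mpsD y z m : (y + z) m = y m + z m.
Proof. by []. Qed.

Lemma mpsZ (c : k) y m : (c *: y) m = c * y m.
Proof. by []. Qed.

Lemma mps1 m : (1 : ps) m = (m == 0%MM)%:R.
Proof. by rewrite /GRing.one /= /mps_const; case: eqP. Qed.

Lemma mps_sum (I : Type) (s : seq I) (F : I -> ps) m :
  (\sum_(i <- s) F i) m = \sum_(i <- s) F i m.
Proof.
elim: s => [|i s IH]; last by rewrite !big_cons mpsD IH.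
by rewrite !big_nil /GRing.zero /= /mps_const if_same.
Qed.

Lemma mpsM_local y z z' m :
  (forall d, (mdeg d <= mdeg m)%N -> z d = z' d) -> (y * z) m = (y * z') m.
Proof.
by move=> zz'; apply: eq_bigr => d _; rewrite zz' // -ltnS bmdeg.
Qed.

Lemma mps_pow_low y j m : y 0%MM = 0 -> (mdeg m < j)%N -> (y ^+ j) m = 0.
Proof.
move=> y0; elim: j m => // j IH m mj; rewrite exprS /GRing.mul /= /mps_mul.
rewrite big1 // => -[d1 d2] /= /eqP mE.
have [d10|d10] := eqVneq (d1 : 'X_{1..n}) 0%MM; first by rewrite d10 y0 mul0r.
rewrite IH ?mulr0 //; move/(congr1 (@mdeg _)): mE; rewrite mdegD.
by move: d10; rewrite -mdeg_eq0; lia.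
Qed.

(** The value at y of the series with coefficients g; in a given degree only
    finitely many powers of y contribute, as y has no constant term. *)
Definition subst g y : ps := fun m => \sum_(j < (mdeg m).+1) g j * (y ^+ j) m.

Lemma subst_trunc g y N m : y 0%MM = 0 -> (mdeg m < N)%N ->
  subst g y m = (\sum_(j < N) g j *: y ^+ j) m.
Proof.
move=> y0 mN; rewrite mps_sum /subst.
rewrite (big_ord_widen N (fun j => g j * (y ^+ j) m) mN) big_mkcond /=.
apply: eq_bigr => j _; rewrite mpsZ; case: ltnP => // mj.
by rewrite mps_pow_low ?mulr0.
Qed.

Lemma subst_rec g y : y 0%MM = 0 ->
  subst g y = g 0 *: 1 + y * subst (fun j => g j.+1) y.
Proof.
move=> y0; apply/funext => m.
rewrite (@subst_trunc _ _ (mdeg m).+2) // mpsD big_ord_recl expr0 mpsD.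
congr (_ + _).
rewrite (@mpsM_local _ _ (\sum_(j < (mdeg m).+1) g j.+1 *: y ^+ j)).
  rewrite mulr_sumr; congr (_ m); apply: eq_bigr => j _.
  by rewrite -scalerAr exprS.
by move=> d dm; rewrite (@subst_trunc _ _ (mdeg m).+1).
Qed.

(** The inverse is a geometric series. *)
Lemma mps_unit y : y 0%MM != 0 -> exists z, y * z = 1.
Proof.
move=> y0; pose u := 1 - (y 0%MM)^-1 *: y.
have u0 : u 0%MM = 0.
  by rewrite /u -scaleN1r mpsD mps1 eqxx !mpsZ mulVf // mulr1 subrr.
exists ((y 0%MM)^-1 *: subst (fun=> 1) u).
rewrite -scalerAr scalerAl.
have -> : (y 0%MM)^-1 *: y = 1 - u by rewrite /u subKr.
by rewrite mulrBl mul1r {1}subst_rec // scale1r addrK.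
Qed.

End Substitution.

Section Weierstrass.
Variable k : fieldType.
Local Notation ps := (mpseries 1 k).
Implicit Types (f u x : ps).

Lemma series_divides f u d : has_order f d -> vanish u d ->
  exists q, u = f * q.
Proof.
move=> [fd f0] ud.
have /mps_unit[z fz] : shift d f 0%MM != 0.
  by rewrite /shift mdeg0 add0n; apply/eqP.
exists (z * shift d u).
by rewrite mulrA {1}(vanish_shiftE fd) -(mulrA (tpow _ _)) fz mulr1 -vanish_shiftE.
Qed.

(** Weierstrass division by x; iterating D expands u in powers of x, with coefficients
    in the span of 1, t, ..., t^(e-1). *)
Lemma series_division x e : has_order x e ->
  exists D : ps -> ps, forall u, u = \sum_(j < e) tcoef u j *: tpow k j + x * D u.
Proof.
move=> xe.
suff /boolp.choice[D DP] u :
    exists q, u = \sum_(j < e) tcoef u j *: tpow k j + x * q by exists D.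
have [|q uq] := @series_divides x (u - \sum_(j < e) tcoef u j *: tpow k j) e xe.
  have tcoef_sum (F : 'I_e -> ps) i : tcoef (\sum_j F j) i = \sum_j tcoef (F j) i.
    by apply: (big_morph (fun f => tcoef f i)) => //; exact: tcoef0.
  move=> i ie; rewrite tcoefD tcoefN tcoef_sum (bigD1 (Ordinal ie)) //=.
  rewrite tcoefZ tcoef_tpow eqxx mulr1 big1 ?addr0 ?subrr // => j.
  by rewrite -val_eqE tcoefZ tcoef_tpow eq_sym /= => /negbTE->; rewrite mulr0.
by exists q; rewrite -uq addrC subrK.
Qed.

End Weierstrass.

(** * The conductor of a parametrized branch *)

Section BranchConductor.
Variables (n : nat) (k : fieldType) (psi : {lrmorphism mpseries n k -> mpseries 1 k}).
Implicit Types (y : mpseries n k) (u : mpseries 1 k).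

(** If the constant term c of psi y were nonzero, then y - c would be a unit, but
    not its image. *)
Lemma lrmorph_const y : tcoef (psi y) 0 = y 0%MM.
Proof.
have psi0 (z : mpseries n k) : z 0%MM = 0 -> tcoef (psi z) 0 = 0.
  move=> z0; apply: contrapT => /eqP c0; set c := tcoef _ _ in c0.
  have /mps_unit[z' zz'] : (z - c *: 1) 0%MM != 0.
    by rewrite -scaleN1r mpsD !mpsZ mps1 eqxx z0 add0r mulr1 mulN1r oppr_eq0.
  have := congr1 (fun v => tcoef (psi v) 0) zz'.
  rewrite /= rmorphM rmorph1 /= tcoefM big_ord1 linearB linearZ rmorph1 /=.
  rewrite tcoefD tcoefN tcoefZ tcoef1 mulr1 subrr mul0r => /esym/eqP.
  by rewrite oner_eq0.
have /psi0 : (y - y 0%MM *: 1) 0%MM = 0.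
  by rewrite -scaleN1r mpsD !mpsZ mps1 eqxx mulr1 mulN1r subrr.
rewrite linearB linearZ rmorph1 /= tcoefD tcoefN tcoefZ tcoef1 mulr1.
by move/eqP; rewrite subr_eq0 => /eqP.
Qed.

Hypothesis psi_frac : forall u, exists a b, psi b <> 0 /\ psi b * u = psi a.

Lemma has_order_in_image : exists y e, y 0%MM = 0 /\ has_order (psi y) e.+1.
Proof.
have [a [b [b0 ba]]] := psi_frac (tpow k 1).
have [d bd] := has_order_ex b0.
have := has_orderM bd (has_order_tpow k 1); rewrite ba addn1 => ad.
by exists a, d; split=> //; rewrite -lrmorph_const; case: ad => + _; apply.
Qed.

(** The image is closed under substitution into x = psi y, which makes k[[t]] a finite
    module over it: the expansion of u in powers of x has its coefficients in the span
    of 1, t, ..., t^(e-1), and sums to u because x has positive order. *)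
Lemma finite_over_image : exists e, forall u, exists s : 'I_e -> mpseries n k,
  u = \sum_(j < e) tpow k j * psi (s j).
Proof.
have [y [e [y0 xe]]] := has_order_in_image.
have [D DE] := series_division xe.
pose g u (j : 'I_e.+1) l := tcoef (iter l D u) j.
pose E u := \sum_(j < e.+1) tpow k j * psi (subst (g u j) y).
have Erec u : E u = \sum_(j < e.+1) tcoef u j *: tpow k j + psi y * E (D u).
  rewrite /E mulr_sumr -big_split; apply: eq_bigr => j _ /=.
  rewrite (@subst_rec _ _ (g u j)) // linearD linearZ rmorph1 rmorphM /=.
  rewrite mulrDr -scalerAr mulr1 mulrCA; congr (_ + _ * (_ * psi (subst _ _))).
  by apply/funext => l; rewrite /g iterSr.
exists e.+1 => u; exists (fun j => subst (g u j) y); rewrite -/(E u).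
apply: series_eq_vanish => N; elim: N u => // N IH u.
have -> : u - E u = psi y * (D u - E (D u)).
  by rewrite [X in X - _]DE Erec opprD addrACA subrr add0r mulrBr.
rewrite -[N.+1]add1n; apply: vanishM => //.
by apply: vanish_weak (proj1 xe).
Qed.

(** Clear the denominators of the finitely many generators. *)
Lemma common_denominator :
  exists b, psi b <> 0 /\ forall u, exists s, psi s = psi b * u.
Proof.
have [e eP] := finite_over_image.
have /boolp.choice[ab abP] (j : 'I_e) : exists ab : mpseries n k * mpseries n k,
    psi ab.2 <> 0 /\ psi ab.2 * tpow k j = psi ab.1.
  by have [a [b abP]] := psi_frac (tpow k j); exists (a, b).
exists (\prod_j (ab j).2); split.
  have neq0 (v w : mpseries 1 k) : v <> 0 -> w <> 0 -> v * w <> 0.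
    move=> /has_order_ex[p vp] /has_order_ex[q wq].
    by apply: has_order_neq0 (has_orderM vp wq).
  rewrite rmorph_prod; elim/big_ind: _ => // [|j _]; last by case: (abP j).
  exact: has_order_neq0 (has_order1 k).
move=> u; have [s ->] := eP u.
exists (\sum_j (\prod_(l | l != j) (ab l).2) * (ab j).1 * s j).
rewrite mulr_sumr linear_sum; apply: eq_bigr => j _.
have [_ abE] := abP j.
by rewrite [in RHS](bigD1 j) //= !rmorphM /= -abE -!mulrA [RHS]mulrCA.
Qed.

End BranchConductor.

(** An element vanishing on all branches but the i-th carries the conductor of that
    branch into the image of the ring in the product. *)
Lemma branches_conductor (n r : nat) (k : fieldType)
    (psi : 'I_r -> {lrmorphism mpseries n k -> mpseries 1 k}) :
    (forall i u, exists a b, psi i b <> 0 /\ psi i b * u = psi i a) ->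
    (forall i, exists2 z, psi i z <> 0 & forall j, j != i -> psi j z = 0) ->
  forall i, exists N, forall u, vanish u N ->
    exists2 s, psi i s = u & forall j, j != i -> psi j s = 0.
Proof.
move=> psi_frac sep i.
have [b [b0 bP]] := common_denominator (psi_frac i).
have [z z0 zP] := sep i.
have [p bp] := has_order_ex b0; have [q zq] := has_order_ex z0.
exists (q + p) => u /(series_divides (has_orderM zq bp))[v ->].
have [s sE] := bP v; exists (z * s); first by rewrite rmorphM /= sE mulrA.
by move=> j /zP zj; rewrite rmorphM /= zj mul0r.
Qed.

(** * Orders in a product of series rings *)

Lemma closed_field_avoid (k : closedFieldType) (s : seq k) : exists x, x \notin s.
Proof.
case: s => [|a s]; first by exists 0.
pose p := \prod_(b <- a :: s) ('X - b%:P) + 1.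
have /closed_rootP[x /rootP px] : size p != 1.
  by rewrite /p size_polyDl size_prod_XsubC ?size_poly1.
exists x; apply: contra_eqN px => xs.
rewrite /p hornerD hornerC.
have /rootP-> : root (\prod_(b <- a :: s) ('X - b%:P)) x by rewrite root_prod_XsubC.
by rewrite add0r oner_neq0.
Qed.

Section ValueCounting.
Variables (k : closedFieldType) (r : nat).
Local Notation W := {ffun 'I_r -> mpseries 1 k}.
Variable A : set W.
Implicit Types (w x y : W) (u : mpseries 1 k) (i j : 'I_r) (a b : 'I_r -> nat).

Definition only i u : W := [ffun j => if j == i then u else 0].

Definition wge a : set W := [set w | forall i, vanish (w i) (a i)].

(** The step from a to a + e_i is hit when the elements of A of order at least a + e_i form
    a proper subspace of those of order at least a.  The components of w other than the
    i-th may be zero. *)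
Definition hit a i : Prop :=
  exists w, [/\ A w, wge a w & tcoef (w i) (a i) <> 0].

Definition value_vector b : Prop :=
  exists w, A w /\ forall i, has_order (w i) (b i).

Lemma wge_subspace a : subspace (wge a).
Proof.
split=> [i|t x y xa ya i]; first by rewrite ffunE; apply: vanish0.
by rewrite !ffunE; apply: vanishD (ya i); apply: vanishZ.
Qed.

Lemma sum_only w : w = \sum_i only i (w i).
Proof.
apply/ffunP => j; rewrite sum_ffunE (bigD1 j) //= ffunE eqxx big1 ?addr0 //.
by move=> i ij; rewrite ffunE eq_sym (negbTE ij).
Qed.

Hypothesis subspaceA : subspace A.

(** The least conductor is found branch by branch, as A is closed under sums of series
    supported on single branches. *)
Lemma least_conductor :
    (forall i, exists N, forall u, vanish u N -> A (only i u)) ->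
  exists c, wge c `<=` A /\
    forall i n, (forall u, vanish u n -> A (only i u)) -> (c i <= n)%N.
Proof.
move=> condA; pose p i n := `[< forall u, vanish u n -> A (only i u) >].
have exp i : exists n, p i n by have [N NP] := condA i; exists N; apply/asboolP.
exists (fun i => ex_minn (exp i)); split=> [w wc|i n np].
  rewrite (sum_only w); apply: subspace_sum => // i _.
  by move: (wc i); case: ex_minnP => n /asboolP np _; apply: np.
by case: ex_minnP => m _; apply; apply/asboolP.
Qed.

Hypothesis A1 : A 1.
Hypothesis AM : forall x y, A x -> A y -> A (x * y).
Variable c : 'I_r -> nat.
Hypothesis cA : wge c `<=` A.
Hypothesis cmin :
  forall i n, (forall u, vanish u n -> A (only i u)) -> (c i <= n)%N.

(** By subtracting multiples of w, the i-th component of the conductor could be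
    lowered. *)
Lemma no_frobenius i w : (0 < c i)%N -> A w ->
  (forall j, j != i -> vanish (w j) (c j)) -> ~ has_order (w i) (c i).-1.
Proof.
move=> ci Aw wc [wi w0].
suff /cmin : forall u, vanish u (c i).-1 -> A (only i u) by rewrite leqNgt ltn_predL ci.
move=> u ui; pose t := tcoef u (c i).-1 / tcoef (w i) (c i).-1.
rewrite -(subrK (t *: w) (only i u)); apply: subspaceD => //; last first.
  exact: subspaceZ.
apply: cA => j; rewrite !ffunE; case: eqP => [->|/eqP ji]; last first.
  by apply: vanishB; [apply: vanish0|apply: vanishZ; apply: wc].
rewrite -(prednK ci); apply: vanishS; first by apply: vanishB => //; apply: vanishZ.
by rewrite tcoefD tcoefN tcoefZ divfK ?subrr //; apply/eqP.
Qed.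

(** If w had order n < c_i at i, its product with t^(c_i - 1 - n) on the i-th branch would
    contradict [no_frobenius]. *)
Lemma conductor_idealE : [set w | forall x, A (w * x)] = wge c.
Proof.
apply/seteqP; split=> w /= wA; last first.
  by move=> x; apply: cA => i; rewrite ffunE mulrC; apply: vanishMl.
move=> i; have [->|/eqP/has_order_ex[n wn]] := eqVneq (w i) 0; first exact: vanish0.
have [cn|nc] := leqP (c i) n; first by apply: vanish_weak cn _; case: wn.
have := has_orderM wn (has_order_tpow k ((c i).-1 - n)).
rewrite subnKC; last by lia.
move=> ord; exfalso.
apply: (@no_frobenius i _ _ (wA (only i (tpow k ((c i).-1 - n))))); first by lia.
  by move=> j ji; rewrite !ffunE (negbTE ji) mulr0; apply: vanish0.
by rewrite !ffunE eqxx.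
Qed.

(** Since orders are nonnegative, truncated subtraction is harmless here: for a_i < c_i, the
    step at this point in the direction i is hit exactly when F_i(S, c - 1 - a) is
    not empty. *)
Definition reflect_step a i : 'I_r -> nat := fun j => (c j - a j - (j == i))%N.

Lemma hit_reflect a i : (a i < c i)%N -> hit a i -> ~ hit (reflect_step a i) i.
Proof.
move=> ai [x [Ax xa x0]] [y [Ay ya y0]].
apply: (@no_frobenius i (x * y)); first 1 [by lia] || idtac.
- exact: AM.
- move=> j ji; rewrite ffunE; apply: vanish_weak (vanishM (xa j) (ya j)).
  by rewrite /reflect_step (negbTE ji); lia.
- have := has_orderM (conj (xa i) x0) (conj (ya i) y0).
  by rewrite ffunE /reflect_step eqxx; congr has_order; lia.
Qed.

Lemma wge_weak a b w : (forall i, (b i <= a i)%N) -> wge a w -> wge b w.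
Proof. by move=> ba wa i; apply: vanish_weak (wa i). Qed.

Lemma hit_weak a b i : (forall j, (b j <= a j)%N) -> b i = a i ->
  hit a i -> hit b i.
Proof.
move=> ba bi [w [Aw wa w0]]; exists w; split=> //; first exact: wge_weak wa.
by rewrite bi.
Qed.

(** Components of order at least c may be changed at will within the ring. *)
Lemma hit_trunc a i : (a i < c i)%N -> hit (fun j => minn (a j) (c j)) i -> hit a i.
Proof.
move=> ai [w [Aw wa w0]].
exists [ffun j => if (c j <= a j)%N then 0 else w j]; split.
- rewrite (_ : [ffun _ => _] = w - [ffun j => if (c j <= a j)%N then w j else 0]).
    apply: subspaceB => //; apply: cA => j; rewrite ffunE.
    case: leqP => ca; last exact: vanish0.
    by move: (wa j); rewrite (minn_idPr ca).
  by apply/ffunP => j; rewrite !ffunE; case: ifP; rewrite ?subrr ?subr0.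
- move=> j; rewrite ffunE; case: leqP => ca; first exact: vanish0.
  by move: (wa j); rewrite (minn_idPl (ltnW ca)).
- by rewrite ffunE leqNgt ai /=; move: w0; rewrite (minn_idPl (ltnW ai)).
Qed.

Lemma hit_value_vector a i : hit a i ->
  exists b, [/\ value_vector b, b i = a i & forall j, (minn (a j) (c j) <= b j)%N].
Proof.
move=> [w [Aw wa w0]].
pose w' : W := [ffun j => if w j == 0 then tpow k (c j) else w j].
have /boolp.choice[b bP] j : exists d, has_order (w' j) d /\ (minn (a j) (c j) <= d)%N.
  rewrite ffunE; case: eqP => [_|/has_order_ex[d wd]].
    by exists (c j); split; [exact: has_order_tpow|lia].
  by exists d; split=> //; have := vanish_has_order (wa j) wd; lia.
exists b; split=> [||j]; last by case: (bP j).
  exists w'; split=> [|j]; last by case: (bP j).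
  rewrite (_ : w' = w + [ffun j => if w j == 0 then tpow k (c j) else 0]).
    apply: subspaceD => //; apply: cA => j; rewrite ffunE.
    by case: eqP => _; [case: (has_order_tpow k (c j))|apply: vanish0].
  by apply/ffunP => j; rewrite !ffunE; case: eqP => [->|]; rewrite ?add0r ?addr0.
apply: (@has_order_uniq _ (w' i)); first by case: (bP i).
rewrite ffunE; case: eqP => [wi|_]; last by split.
by case: w0; rewrite wi tcoef0.
Qed.

(** A generic linear combination of the witnesses attains all the orders at once:
    the finitely many cancellations are avoided as k is infinite. *)
Lemma value_vector_hit a : (forall i, hit a i) -> value_vector a.
Proof.
move=> ha.
suff [w [Aw wa w0]] : exists w, [/\ A w, wge a w
    & forall i, i \in enum 'I_r -> tcoef (w i) (a i) <> 0].
  by exists w; split=> // i; split; [exact: wa|apply: w0; rewrite mem_enum].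
elim: (enum _) => [|i s [w [Aw wa w0]]].
  by exists 0; split=> //; case: (wge_subspace a) => //; case: subspaceA.
have [x [Ax xa x0]] := ha i.
(* t avoids the multipliers of x that cancel a leading coefficient of w *)
have [t ts] := closed_field_avoid
  [seq - tcoef (w j) (a j) / tcoef (x j) (a j) | j <- i :: s].
exists (t *: x + w); split.
- by case: subspaceA => _; apply.
- by case: (wge_subspace a) => _; apply.
move=> j js; rewrite !ffunE tcoefD tcoefZ => /eqP; rewrite addr_eq0 => /eqP tE.
have [xj|xj] := eqVneq (tcoef (x j) (a j)) 0.
  move: js; rewrite inE => /orP[/eqP ji|/w0]; first by rewrite ji in xj.
  by move/eqP: tE; rewrite xj mulr0 eq_sym oppr_eq0 => /eqP.
by move/negP: ts; apply; apply/mapP; exists j; rewrite // -tE mulfK.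
Qed.

Lemma value_vector_hits a i : value_vector a -> hit a i.
Proof.
by move=> [w [Aw wo]]; exists w; split=> // [j|]; [case: (wo j)|case: (wo i)].
Qed.

(** * Counting dimensions along paths *)

(** A path of unit steps is the sequence of their directions, and [cnt s] is the point that
    it reaches from 0. *)
Definition cnt (s : seq 'I_r) : 'I_r -> nat := fun i => count_mem i s.

Lemma cnt_ex a : exists s, cnt s = a.
Proof.
exists (flatten [seq nseq (a j) j | j <- enum 'I_r]); apply/funext => i.
rewrite /cnt count_flatten -map_comp sumnE big_map big_enum /=.
rewrite (bigD1 i) //= count_nseq /= eqxx mul1n big1 ?addn0 // => j ji.
by rewrite count_nseq /= (negbTE ji).
Qed.

Lemma wge_cons i s w :
  wge (cnt (i :: s)) w <-> wge (cnt s) w /\ tcoef (w i) (cnt s i) = 0.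
Proof.
split=> [wi|[ws wi] j].
  split; first by apply: wge_weak wi => j; rewrite /cnt /=; lia.
  by apply: (wi i); rewrite /cnt /= eqxx.
rewrite /cnt /=; case: eqP => [<-|_]; last exact: ws.
by rewrite add1n; apply: vanishS (ws i) wi.
Qed.

Lemma wge_cancel i s w y : wge (cnt s) w -> wge (cnt s) y ->
  tcoef (y i) (cnt s i) <> 0 -> exists t : k, wge (cnt (i :: s)) (w - t *: y).
Proof.
move=> ws ys y0; exists (tcoef (w i) (cnt s i) / tcoef (y i) (cnt s i)).
apply/wge_cons; split.
  by apply: subspaceB (wge_subspace _) _ _ => //; apply: subspaceZ (wge_subspace _) _.
by rewrite !ffunE tcoefD tcoefN tcoefZ divfK ?subrr //; apply/eqP.
Qed.

Definition hitb a i : bool := `[< hit a i >].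

(** The path s continues the path p, listed from its last step to its first. *)
Fixpoint hits (p s : seq 'I_r) : nat :=
  if s is i :: s' then hitb (cnt p) i + hits (i :: p) s' else 0.

Fixpoint misses (p s : seq 'I_r) : nat :=
  if s is i :: s' then ~~ hitb (cnt p) i + misses (i :: p) s' else 0.

(** The hits on the path reflected to s, which is s walked backwards: the point reached
    before its last step is what remains of s. *)
Fixpoint reverse_hits (s : seq 'I_r) : nat :=
  if s is i :: s' then hitb (cnt s') i + reverse_hits s' else 0.

Lemma hits_misses p s : (hits p s + misses p s)%N = size s.
Proof. by elim: s p => //= i s IH p; rewrite -(IH (i :: p)); case: hitb => /=; lia. Qed.

Lemma hits_rcons p s i :
  hits p (rcons s i) = (hits p s + hitb (fun j => cnt p j + cnt s j)%N i)%N.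
Proof.
elim: s p => [|j s IH] p /=.
  by rewrite addn0 add0n; congr (nat_of_bool (hitb _ _)); apply/funext => l; rewrite addn0.
rewrite IH addnA; congr (_ + nat_of_bool (hitb _ _))%N; apply/funext => l.
by rewrite /cnt /=; lia.
Qed.

Lemma hits_rev s : hits [::] (rev s) = reverse_hits s.
Proof.
elim: s => //= i s IH; rewrite rev_cons hits_rcons IH addnC.
congr (nat_of_bool (hitb _ _) + _)%N; apply/funext => l.
by rewrite /cnt /= count_rev.
Qed.

Lemma dim_hits p s : (forall i, (cnt p i + cnt s i)%N = c i) ->
  quot_dim_eq (A `&` wge (cnt p)) (wge c) (hits p s).
Proof.
have sAw a : subspace (A `&` wge a).
  split=> [|t x y [Ax xa] [Ay ya]].
    by split; [case: subspaceA|case: (wge_subspace a)].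
  by split; [apply: (proj2 subspaceA)|apply: (proj2 (wge_subspace a))].
elim: s p => [|i s IH] p pc.
  rewrite (_ : cnt p = c); last by apply/funext => i; rewrite -pc addn0.
  by rewrite setIidr //; apply: quot_dim_refl; apply: wge_subspace.
have {}pc j : (cnt (i :: p) j + cnt s j)%N = c j by rewrite -pc /cnt /=; lia.
have {}IH := IH _ pc.
rewrite /= /hitb; case: asboolP => [[w [Aw wp w0]]|nh].
  rewrite add1n; apply: (quot_dim_step (w := w)) IH => //.
  - exact: wge_subspace.
  - by move=> x xc; split; [apply: cA|apply: wge_weak xc => j; rewrite -pc leq_addr].
  - by move=> [_ /wge_cons[_]].
  - by move=> x [Ax /wge_cons[xp _]].
  - move=> x [Ax xp]; have [t xt] := wge_cancel xp wp w0; exists t.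
    by split=> //; apply: subspaceB => //; apply: subspaceZ.
rewrite add0n (_ : A `&` wge (cnt p) = A `&` wge (cnt (i :: p))) //.
apply/seteqP; split=> x [Ax xp]; split=> //; last by case/wge_cons: xp.
apply/wge_cons; split=> //; apply: contrapT => x0.
by apply: nh; exists x.
Qed.

(** A step that is missed is a dimension of W / A, spanned by the power of t supported on
    the i-th branch: the quotient of W(a) + A by W(a + e_i) + A, where W(a) denotes the series
    of order at least a. *)
Lemma dim_misses p s : (forall i, (cnt p i + cnt s i)%N = c i) ->
  quot_dim_eq [set x | exists2 w, wge (cnt p) w & A (x - w)] A (misses p s).
Proof.
have sM a : subspace [set x | exists2 w, wge a w & A (x - w)].
  have [w0 wP] := wge_subspace a; have [A0 AP] := subspaceA.
  split=> [|t x y [w wa Aw] [w' wa' Aw']]; first by exists 0; rewrite ?subrr.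
  exists (t *: w + w'); first exact: wP.
  by rewrite opprD addrACA -scalerBr; apply: AP.
elim: s p => [|i s IH] p pc.
  rewrite (_ : [set x | _] = A); first exact: quot_dim_refl.
  have pcE : cnt p = c by apply/funext => i; rewrite -pc addn0.
  apply/seteqP; split=> [x [w wp Axw]|x Ax].
    by rewrite -(subrK w x); apply: subspaceD => //; apply: cA; rewrite -pcE.
  by exists 0; [case: (wge_subspace (cnt p))|rewrite subr0].
have {}pc j : (cnt (i :: p) j + cnt s j)%N = c j by rewrite -pc /cnt /=; lia.
have {}IH := IH _ pc.
rewrite /= /hitb; case: asboolP => [[w [Aw wp w0]]|nh] /=.
  rewrite add0n (_ : [set x | exists2 w, wge (cnt p) w & A (x - w)] =
    [set x | exists2 w, wge (cnt (i :: p)) w & A (x - w)]) //.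
  apply/seteqP; split=> x [y yp Axy]; last by exists y => //; case/wge_cons: yp.
  have [t yt] := wge_cancel yp wp w0; exists (y - t *: w) => //.
  by rewrite opprB addrA addrAC; apply: subspaceD => //; apply: subspaceZ.
pose e := only i (tpow k (cnt p i)).
have ep : wge (cnt p) e.
  move=> j; rewrite ffunE; case: eqP => [->|_]; last exact: vanish0.
  by case: (has_order_tpow k (cnt p i)).
have e0 : tcoef (e i) (cnt p i) <> 0.
  by rewrite ffunE eqxx; case: (has_order_tpow k (cnt p i)).
rewrite add1n; apply: (quot_dim_step (w := e)) IH => //.
- move=> x Ax; exists 0; last by rewrite subr0.
  by case: (wge_subspace (cnt (i :: p))).
- by exists e; rewrite ?subrr //; case: subspaceA.
- move=> [w /wge_cons[wp wi] Aew]; apply: nh; exists (e - w); split=> //.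
    by apply: subspaceB (wge_subspace _) _ _.
  by rewrite !ffunE tcoefD tcoefN wi subr0; move: e0; rewrite ffunE.
- by move=> x [w /wge_cons[wp _]]; exists w.
- move=> x [w wp Axw]; have [t wt] := wge_cancel wp ep e0; exists t.
  by exists (w - t *: e) => //; rewrite opprB addrA subrK.
Qed.

Definition gorenstein_balance : Prop :=
  exists d, quot_dim_eq A (wge c) d /\ quot_dim_eq setT A d.

Definition complementary_steps : Prop :=
  forall a i, (forall j, (a j <= c j)%N) -> (a i < c i)%N ->
    hit a i \/ hit (reflect_step a i) i.

(** Both count the dimension of A / C, along a path and its reversal. *)
Lemma hits_reverse_hits s : cnt s = c -> hits [::] s = reverse_hits s.
Proof.
move=> sc; rewrite -hits_rev.
have dim s' : (forall i, cnt s' i = c i) ->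
    quot_dim_eq (A `&` wge (cnt [::])) (wge c) (hits [::] s').
  by move=> sc'; apply: dim_hits => i; rewrite /= add0n.
apply: quot_dim_uniq (wge_subspace c) (dim _ _) (dim _ _) => i; first by rewrite sc.
by rewrite /cnt count_rev -sc.
Qed.

Lemma gorenstein_balanceE s : cnt s = c ->
  gorenstein_balance <-> (hits [::] s + reverse_hits s)%N = size s.
Proof.
move=> sc.
have dimA : quot_dim_eq A (wge c) (hits [::] s).
  by have := @dim_hits [::] s; rewrite setIidl //; apply => i; rewrite sc.
have dimO : quot_dim_eq setT A (misses [::] s).
  have := @dim_misses [::] s; rewrite (_ : [set x | _] = setT); last first.
    by apply/seteqP; split=> // x _; exists x; rewrite ?subrr //; case: subspaceA.
  by apply => i; rewrite sc.
rewrite -hits_reverse_hits // -(hits_misses [::] s).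
split=> [[d [dA dO]]|/addnI dE]; last by exists (hits [::] s); rewrite {2}dE.
have := quot_dim_uniq (wge_subspace c) dA dimA.
by have := quot_dim_uniq subspaceA dO dimO => -> ->.
Qed.

(** Each step of s contributes at most 1 to the left-hand side together with its
    reflection, so that equality holds when every step contributes. *)
Lemma balance_steps p s : (forall i, (cnt p i + cnt s i)%N = c i) ->
  (hits p s + reverse_hits s <= size s)%N /\
  ((hits p s + reverse_hits s)%N = size s <->
   forall q i q', s = q ++ i :: q' -> hit (cnt (rev q ++ p)) i \/ hit (cnt q') i).
Proof.
elim: s p => [|i s IH] p pc.
  by split=> //; split=> // _ [|? ?] ? ?.
have pi : (cnt p i < c i)%N by rewrite -pc /cnt /= eqxx; lia.
have sE : reflect_step (cnt p) i = cnt s.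
  apply/funext => j; rewrite /reflect_step -pc /cnt /= eq_sym; lia.
have le1 : (hitb (cnt p) i + hitb (cnt s) i <= 1)%N.
  rewrite /hitb; case: asboolP => [h1|_]; case: asboolP => // h2.
  by case: (hit_reflect pi h1); rewrite sE.
have {}pc j : (cnt (i :: p) j + cnt s j)%N = c j by rewrite -pc /cnt /=; lia.
have [le IHs] := IH _ pc; split=> /=; first by lia.
split=> [eq q j q'|all].
  have [eq1 /IHs eq2] : (hitb (cnt p) i + hitb (cnt s) i)%N = 1 /\
    (hits (i :: p) s + reverse_hits s)%N = size s by split; lia.
  case: q => [|l q] [<-] => [<-|sq] /=; last first.
    by rewrite rev_cons cat_rcons; apply: eq2.
  move: eq1; rewrite /hitb; case: asboolP => [|_]; first by left.
  by case: asboolP => // h _; right.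
have : (hits (i :: p) s + reverse_hits s)%N = size s.
  apply/IHs => q j q' sE'; have := all (i :: q) j q'; rewrite sE' /= => /(_ erefl).
  by rewrite rev_cons cat_rcons.
have : (hitb (cnt p) i + hitb (cnt s) i)%N = 1.
  move: le1; rewrite /hitb; case: asboolP => h1; case: asboolP => h2 //.
  by case: (all [::] i s erefl).
by lia.
Qed.

Lemma gorenstein_complementary : gorenstein_balance <-> complementary_steps.
Proof.
split=> [G a i ac ai|C].
  have [q qa] := cnt_ex a; have [q' qa'] := cnt_ex (reflect_step a i).
  have sc : cnt (rev q ++ i :: q') = c.
    apply/funext => j; rewrite /cnt count_cat count_rev /=.
    rewrite -!/(cnt _ _) qa qa' /reflect_step eq_sym.
    by have := ac j; case: eqP => [->|_]; lia.
  have /(@balance_steps [::] _)[_ bal] : forall j, (cnt [::] j + cnt (rev q ++ i :: q') j)%N = c j.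
    by move=> j; rewrite sc.
  have /bal/(_ (rev q) i q' erefl) := (gorenstein_balanceE sc).1 G.
  by rewrite revK cats0 qa qa'.
have [s sc] := cnt_ex c; apply/(gorenstein_balanceE sc).
have /balance_steps[_ ->] : forall j, (cnt [::] j + cnt s j)%N = c j by move=> j; rewrite sc.
move=> q i q' sE.
have csE j : c j = (cnt q j + ((i == j) + cnt q' j))%N.
  by rewrite -sc sE /cnt count_cat.
have -> : cnt q' = reflect_step (cnt q) i.
  by apply/funext => j; rewrite /reflect_step csE eq_sym; lia.
have -> : cnt (rev q ++ [::]) = cnt q.
  by apply/funext => j; rewrite cats0 /cnt count_rev.
by apply: C => [j|]; rewrite csE ?eqxx; lia.
Qed.

(** * Symmetry of the values *)

Definition symmetric_values : Prop :=
  forall a, value_vector a <->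
    forall i, (a i < c i)%N -> ~ hit (reflect_step a i) i.

Lemma value_vector_reflect a i : value_vector a -> (a i < c i)%N ->
  ~ hit (reflect_step a i) i.
Proof. by move=> va ai; apply: (hit_reflect ai); apply: value_vector_hits. Qed.

(** Steps outside the box below c are moved into it by truncating a at c. *)
Lemma complementary_symmetric : complementary_steps -> symmetric_values.
Proof.
move=> C a; split=> [/value_vector_reflect h i|na]; first exact: h.
apply: value_vector_hit => i; have [ca|ac] := leqP (c i) (a i).
  exists (only i (tpow k (a i))); have [ta t0] := has_order_tpow k (a i); split.
  - apply: cA => j; rewrite ffunE; case: eqP => [->|_]; last exact: vanish0.
    exact: vanish_weak ta.
  - move=> j; rewrite ffunE; case: eqP => [->//|_]; exact: vanish0.
  - by rewrite ffunE eqxx.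
apply: hit_trunc => //.
have [||//|h] := C (fun j => minn (a j) (c j)) i; [by move=> j; lia|by lia|].
case: (na _ ac); apply: hit_weak h => [j|]; rewrite /reflect_step; lia.
Qed.

(** Raise a in the directions j other than i as long as the reflected step is
    missed. *)
Lemma saturate a i : ~ hit (reflect_step a i) i ->
  exists b, [/\ forall j, (a j <= b j)%N, b i = a i, ~ hit (reflect_step b i) i
    & forall j, j != i -> (b j < c j)%N ->
        hit (reflect_step (fun l => b l + (l == j))%N i) i].
Proof.
move: {2}(\sum_j (c j - a j))%N (leqnn (\sum_j (c j - a j))%N) => n.
elim: n a => [|n IH] a an nh.
  exists a; split=> // j ji aj.
  by move: an; rewrite (bigD1 j) //=; lia.
have [sat|] := pselect (forall j, j != i -> (a j < c j)%N ->
    hit (reflect_step (fun l => a l + (l == j))%N i) i); first by exists a.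
move=> /existsNP[j] /not_implyP[ji] /not_implyP[aj nhj].
have [|b [ab bi nb sat]] := IH _ _ nhj; last first.
- exists b; split=> // [l|]; first by have := ab l; lia.
  by rewrite bi eq_sym (negbTE ji) addn0.
rewrite -ltnS; apply: leq_trans an.
rewrite (bigD1 j) //= [X in (_ < X)%N](bigD1 j) //= eqxx.
rewrite (eq_bigr (fun l => c l - a l)%N); first by lia.
by move=> l /negbTE->; rewrite addn0.
Qed.

(** If neither step is hit, pass to a saturated b.  It is not a value, so by symmetry the
    reflected step of b is hit in some direction j, and j is not i.  Saturation in the
    direction j provides a second element, of the same order in the j-th component, and the
    combination of the two that cancels the leading terms there hits the reflected step
    of b in the direction i. *)
Lemma symmetric_complementary : symmetric_values -> complementary_steps.
Proof.
move=> Sy a i ac ai; apply: contrapT => /not_orP[na nr].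
have [b [ab bi nb sat]] := saturate nr.
have nvb : ~ value_vector b.
  by move=> /(@value_vector_hits _ i)/(hit_weak ab); rewrite bi => /(_ erefl).
have [j [bj hj]] : exists j, (b j < c j)%N /\ hit (reflect_step b j) j.
  apply: contrapT => no; apply: nvb; apply/Sy => j bj hj.
  by apply: no; exists j.
have ji : j != i by apply: contra_notN nb => /eqP <-.
have [x [Ax xb x0]] := sat j ji bj; have [y [Ay yb y0]] := hj.
apply: nb; set t := tcoef (x j) (reflect_step b j j) / tcoef (y j) (reflect_step b j j).
exists (x - t *: y).
have yl l : l != j -> vanish (y l) (c l - b l).
  by move=> lj; have := yb l; rewrite /reflect_step (negbTE lj) subn0.
split; first by apply: subspaceB => //; apply: subspaceZ.
- move=> l; rewrite !ffunE; have [->{l}|lj] := eqVneq l j; last first.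
    apply: vanishB; last first.
      by apply: vanishZ; apply: vanish_weak (yl _ lj); rewrite /reflect_step; lia.
    by apply: vanish_weak (xb l); rewrite /reflect_step (negbTE lj); lia.
  have -> : reflect_step b i j = (reflect_step b j j).+1.
    by rewrite /reflect_step eqxx (negbTE ji); lia.
  apply: vanishS; last by rewrite tcoefD tcoefN tcoefZ divfK ?subrr //; apply/eqP.
  apply: vanishB; last by apply: vanishZ; apply: yb.
  by apply: vanish_weak (xb j); rewrite /reflect_step eqxx (negbTE ji); lia.
- rewrite !ffunE tcoefD tcoefN tcoefZ (@yl i) 1?eq_sym //; last first.
    by rewrite /reflect_step eqxx; lia.
  by rewrite mulr0 subr0; move: x0; rewrite /reflect_step eqxx eq_sym (negbTE ji) addn0.
Qed.

Theorem gorenstein_symmetric_values : gorenstein_balance <-> symmetric_values.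
Proof.
by rewrite gorenstein_complementary; split;
  [exact: complementary_symmetric|exact: symmetric_complementary].
Qed.

(** * The semigroup as a set of integer vectors *)

Definition to_zvec b : {ffun 'I_r -> int} := [ffun i => (b i)%:Z].

Lemma to_zvecE b i : to_zvec b i = b i :> int. Proof. exact: ffunE. Qed.

Definition value_set : set {ffun 'I_r -> int} :=
  [set z | exists2 b, value_vector b & z = to_zvec b].

Lemma value_set_to_zvec b : value_set (to_zvec b) <-> value_vector b.
Proof.
split=> [[b' vb' /ffunP bE]|vb]; last by exists b.
rewrite (_ : b = b') //; apply/funext => i.
by have := bE i; rewrite !to_zvecE => -[].
Qed.

Lemma natural_to_zvec (z : {ffun 'I_r -> int}) :
  natural z -> exists b, z = to_zvec b.
Proof.
move=> nz; exists (fun i => `|z i|%N); apply/ffunP => i; rewrite to_zvecE.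
by rewrite gez0_abs //; have := nz i; rewrite ffunE.
Qed.

Lemma value_vector_above b : (forall i, (c i <= b i)%N) -> value_vector b.
Proof.
move=> cb; exists [ffun i => tpow k (b i)]; split=> [|i]; rewrite ?ffunE.
  apply: cA => i; rewrite ffunE; apply: vanish_weak (cb i) _.
  by case: (has_order_tpow k (b i)).
exact: has_order_tpow.
Qed.

(** A series of order at least b is reduced, one term after the other, modulo
    elements of A, until its order is at least c. *)
Lemma wge_of_values b : (forall b', (forall i, (b i <= b' i)%N) -> value_vector b') ->
  wge b `<=` A.
Proof.
move: {2}(\sum_j (c j - b j))%N (leqnn (\sum_j (c j - b j))%N) => n.
elim: n b => [|n IH] b bn vb w wb.
  apply: cA => i; apply: vanish_weak (wb i).
  by move: bn; rewrite (bigD1 i) //=; lia.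
have [cb|] := pselect (forall i, (c i <= b i)%N).
  by apply: cA => i; apply: vanish_weak (wb i).
move=> /existsNP[i] /negP; rewrite -ltnNge => bi.
have [s sb] := cnt_ex b.
have [y [Ay yb]] := vb b (fun=> leqnn _).
have [|||t wt] := @wge_cancel i s w y; rewrite ?sb //; try by case: (yb i).
  by move=> j; case: (yb j).
rewrite -(subrK (t *: y) w); apply: subspaceD => //; last exact: subspaceZ.
apply: IH wt => [|b' bb'].
  rewrite -ltnS; apply: leq_trans bn.
  rewrite (bigD1 i) //= [X in (_ < X)%N](bigD1 i) //= {1}/cnt /= eqxx.
  rewrite (eq_bigr (fun j => c j - b j)%N) => [|j ji].
    by rewrite -/(cnt s i) sb; lia.
  by rewrite /cnt /= eq_sym (negbTE ji) -/(cnt s j) sb.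
by apply: vb => j; apply: leq_trans (bb' j); rewrite -sb /cnt /= leq_addl.
Qed.

Lemma value_set_conductor z : natural z -> value_set (to_zvec c + z).
Proof.
move=> /natural_to_zvec[b ->]; exists (fun i => c i + b i)%N.
  by apply: value_vector_above => i; apply: leq_addr.
by apply/ffunP => i; rewrite !ffunE PoszD.
Qed.

Lemma conductor_value_set : conductor value_set = to_zvec c.
Proof.
have candidate : conductor_candidates value_set (to_zvec c).
  split=> [|z]; last exact: value_set_conductor.
  by apply/value_set_to_zvec/value_vector_above.
have least d : conductor_candidates value_set d -> cw_le (to_zvec c) d.
  move=> [[b _ ->] bS] i; rewrite !to_zvecE lez_nat.
  apply: cmin => u ui; apply: (@wge_of_values b) => [b' bb'|j].
    apply/value_set_to_zvec.
    rewrite (_ : to_zvec b' = to_zvec b + to_zvec (fun j => b' j - b j)%N).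
      by apply: bS => j; rewrite to_zvecE ffunE.
    by apply/ffunP => j; rewrite !ffunE -PoszD subnKC.
  by rewrite ffunE; case: eqP => [->|_]; last exact: vanish0.
apply: xget_unique => [//|d [/least cd /(_ _ candidate) dc]].
by apply/ffunP => i; apply/le_anti; rewrite dc cd.
Qed.

Lemma FS_reflect_hit b :
  FS value_set (frobenius value_set - to_zvec b) = set0 <->
  forall i, (b i < c i)%N -> ~ hit (reflect_step b i) i.
Proof.
have fE i : (frobenius value_set - to_zvec b) i = (c i)%:Z - 1 - (b i)%:Z :> int.
  by rewrite !ffunE conductor_value_set ffunE.
split=> [F0 i bi /hit_value_vector[v [vv vi vge]]|nh].
  suff : FS value_set (frobenius value_set - to_zvec b) (to_zvec v) by rewrite F0.
  split; last by apply/value_set_to_zvec.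
  exists i => //; split=> [|j ji]; rewrite fE to_zvecE.
    by rewrite vi /reflect_step eqxx; lia.
  by have := vge j; rewrite /reflect_step (negbTE ji); lia.
apply/seteqP; split=> // z [[i _ [zi zj]] [v vv zE]]; subst z.
move: zi; rewrite fE to_zvecE => vi.
have bi : (b i < c i)%N by lia.
apply: (nh i bi); apply: hit_weak (@value_vector_hits v i vv) => [j|].
  have [->|ji] := eqVneq j i; first by rewrite /reflect_step eqxx; lia.
  by have := zj j ji; rewrite fE to_zvecE /reflect_step (negbTE ji); lia.
by rewrite /reflect_step eqxx; lia.
Qed.

Lemma symmetric_value_set : symmetric_semigroup value_set <-> symmetric_values.
Proof.
split=> [Sy b|Sy z /natural_to_zvec[b ->]]; last first.
  by rewrite value_set_to_zvec FS_reflect_hit.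
rewrite -FS_reflect_hit -value_set_to_zvec; apply: Sy => i.
by rewrite to_zvecE ffunE.
Qed.

Lemma value_set_natural : value_set `<=` @natural r.
Proof. by move=> _ [b _ ->] i; rewrite to_zvecE ffunE. Qed.

Lemma value_setD (y z : {ffun 'I_r -> int}) :
  value_set y -> value_set z -> value_set (y + z).
Proof.
move=> [b [w [Aw wb]] ->] [b' [w' [Aw' wb']] ->].
exists (fun i => b i + b' i)%N; last by apply/ffunP => i; rewrite !ffunE PoszD.
by exists (w * w'); split=> [|i]; [exact: AM|rewrite ffunE; apply: has_orderM].
Qed.

Lemma FS_frobenius_value_set : FS value_set (frobenius value_set) = set0.
Proof.
have to0 : to_zvec (fun=> 0%N) = 0 by apply/ffunP => i; rewrite !ffunE.
rewrite -[frobenius _]subr0 -to0; apply/FS_reflect_hit => i.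
apply: value_vector_reflect; exists 1; split=> // j.
by rewrite ffunE; apply: has_order1.
Qed.

(** Locality of A says that its elements have the same constant term on all branches, so
    that an order that is zero on one branch is zero on all of them. *)
Lemma value_set_positive z :
    (forall w, A w -> forall i j, tcoef (w i) 0 = tcoef (w j) 0) ->
  value_set z -> z <> 0 -> forall i, 0 < z i.
Proof.
move=> local [b [w [Aw wb]] ->] z0 i; rewrite to_zvecE ltz_nat lt0n.
apply/eqP => bi; apply: z0; apply/ffunP => j; rewrite to_zvecE ffunE.
congr Posz; apply/eqP; rewrite -leqn0 leqNgt; apply/negP => bj.
have [_] := wb i; rewrite bi (local w Aw i j); apply.
by case: (wb j) => + _; apply.
Qed.

End ValueCounting.

(** * Symmetry and the Apery set *)

Section AperySymmetry.
Variable r : nat.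
Implicit Types (a b : {ffun 'I_r -> int}) (i j : 'I_r).

(** These fix the types of the components of a vector to be [int] syntactically, which
    the arithmetic decision procedure relies on. *)
Lemma zrD a b i : (a + b) i = a i + b i :> int. Proof. exact: ffunE. Qed.

Lemma zrN a i : (- a) i = - a i :> int. Proof. exact: ffunE. Qed.

Lemma zr0 i : (0%R : {ffun 'I_r -> int}) i = 0 :> int. Proof. exact: ffunE. Qed.

Lemma zrMn a n i : (a *+ n) i = a i * n%:Z :> int.
Proof. by rewrite ffunMnE -mulr_natr natz. Qed.

Lemma frobeniusE (S : set {ffun 'I_r -> int}) i :
  frobenius S i = conductor S i - 1 :> int.
Proof. exact: ffunE. Qed.

Definition zrE := (zrD, zrN, zrMn, frobeniusE).

Variable S : set {ffun 'I_r -> int}.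
Local Notation f := (frobenius S).

Hypothesis S_natural : S `<=` @natural r.
Hypothesis SD : forall a b, S a -> S b -> S (a + b).
Hypothesis S_conductor : forall a, natural a -> S (conductor S + a).
Hypothesis FS_frobenius : FS S f = set0.

Lemma mem_above_conductor a : cw_le (conductor S) a -> S a.
Proof.
move=> ca; rewrite -(subrKC (conductor S) a); apply: S_conductor => i.
by have := ca i; rewrite zr0 !zrE; lia.
Qed.

Lemma FS_reflect_mem a : S a -> FS S (f - a) = set0.
Proof.
move=> Sa; apply/seteqP; split=> // b [[i _ [bi bj]] Sb].
suff : FS S f (a + b) by rewrite FS_frobenius.
split; last exact: SD Sa Sb.
move: bi; rewrite !zrE => bi.
exists i => //; split=> [|j /bj]; rewrite !zrE ?bi; lia.
Qed.

(** Where a is negative in the i-th component, the i-th component of f - a is at least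
    that of the conductor. *)
Lemma FS_reflect_negative a : ~ natural a -> FS S (f - a) <> set0.
Proof.
move=> /existsNP[i]; rewrite zr0 => /negP ai.
pose b := [ffun j => if j == i then f i - a i
                     else Num.max (conductor S j) (f j - a j + 1)].
have bE j : b j = if j == i then f i - a i
                     else Num.max (conductor S j) (f j - a j + 1) by rewrite ffunE.
suff : FS S (f - a) b by move=> + S0; rewrite S0.
split.
  exists i => //; split=> [|j /negbTE ji]; rewrite !(bE, zrE) ?eqxx ?ji; lia.
by apply: mem_above_conductor => j; rewrite !(bE, zrE); case: eqP => [->|_]; lia.
Qed.

Lemma symmetric_everywhere a : symmetric_semigroup S ->
  S a <-> FS S (f - a) = set0.
Proof.
move=> Sy; have [/Sy//|na] := pselect (natural a).
by split=> [/S_natural//|/(FS_reflect_negative na)].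
Qed.

(** For a outside S, the least n such that a + n alpha is in S gives an element of the
    Apery set, and an element of F(S, f - (a + (n - 1) alpha)) becomes one
    of F(S, f - a) when (n - 1) alpha is added. *)
Lemma symmetric_apery alpha : S alpha -> (forall i, 0 < alpha i) ->
  symmetric_semigroup S <->
  forall a, natural a -> apery S alpha a ->
    FS S (f + alpha - a) <> set0 /\ FS S (f + alpha - a) `<=` apery S alpha.
Proof.
move=> Sal al0; have fE a : f + alpha - a = f - (a - alpha).
  by rewrite opprB addrA addrAC -!addrA [- a + _]addrC.
split=> [Sy a _ [Sa nSa]|H a na].
  rewrite fE; split=> [/(symmetric_everywhere _ Sy)//|b [[i _ [bi bj]] Sb]].
  split=> // Sba; have : FS S (f - a) (b - alpha).
    split=> //; exists i => //; move: bi; rewrite !zrE => bi.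
    by split=> [|j /bj]; rewrite !zrE ?bi; lia.
  by rewrite FS_reflect_mem.
split; first exact: FS_reflect_mem.
move=> FSa; apply: contrapT => nSa.
have exn : exists n, `[< S (a + alpha *+ n) >].
  (* this multiple is large enough as all the components of alpha are at least 1 *)
  exists (\sum_i `|conductor S i|)%N; apply/asboolP/mem_above_conductor => i.
  have := na i; rewrite zr0 !zrE (bigD1 i) //=.
  set m := (\sum_(_ < _ | _) _)%N.
  have := al0 i; nia.
case/ex_minnP: exn => -[|n] /asboolP Sn nmin; first by rewrite addr0 in Sn.
have nS : ~ S (a + alpha *+ n) by move=> /asboolP/nmin; rewrite ltnn.
have [] := H (a + alpha *+ n.+1); first exact: S_natural.
  by split=> //; rewrite mulrSr addrA addrK.
rewrite fE mulrSr addrA addrK => FSn _; apply: FSn.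
have SM m : forall b, S b -> S (b + alpha *+ m).
  elim: m => [|m IH] b Sb; first by rewrite addr0.
  by rewrite mulrSr addrA; apply/SD/Sal/IH.
apply/seteqP; split=> // b [[i _ [bi bj]] Sb].
suff : FS S (f - a) (b + alpha *+ n) by rewrite FSa.
split; last exact: SM.
move: bi; rewrite !zrE => bi.
by exists i => //; split=> [|j /bj]; rewrite !zrE ?bi; lia.
Qed.

End AperySymmetry.

(** * The ring of a curve inside the product of its branches *)

Lemma fraction_numden (R : idomainType) (z : {fraction R}) :
  exists p q : R, q != 0 /\ z * FracField.tofrac q = FracField.tofrac p.
Proof.
elim/quotW: z => x; exists \n_x, \d_x; split; first exact: denom_ratioP.
rewrite [RHS]/FracField.tofrac [X in _ * X]/FracField.tofrac; unlock FracField.tofrac.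
rewrite -[LHS]FracField.pi_mul; apply/eqmodP; rewrite /= FracField.equivfE.
rewrite /FracField.mulf !numden_Ratio ?oner_neq0 ?mulr1 ?denom_ratioP //.
by rewrite mulrC.
Qed.

Lemma value_eqE (k K : fieldType) (phi : {rmorphism mpseries 1 k -> K}) w z :
  injective phi ->
  value_eq phi (phi w) z <-> exists2 n, has_order w n & z = n%:Z.
Proof.
move=> phi_inj; split=> [[f [g [a [b [/order_eqE fa /order_eqE gb wE ->]]]]]|[n wn ->]].
  have {}wE : w * g = f by apply: phi_inj; rewrite rmorphM.
  have /has_order_ex[n wn] : w <> 0.
    by move=> w0; apply: (has_order_neq0 fa); rewrite -wE w0 mul0r.
  exists n => //; have := has_order_uniq (has_orderM wn gb); rewrite wE => /(_ _ fa) <-.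
  by rewrite PoszD addrK.
exists w, 1, n, 0; split; [exact/order_eqE|exact/order_eqE/has_order1| |].
  by rewrite rmorph1 mulr1.
by rewrite subr0.
Qed.

Section Curve.
Variables (k : closedFieldType) (O : comAlgType k) (r : nat).
Variable P : 'I_r -> prime_idealr O.
Variable phi : forall i, {rmorphism mpseries 1 k -> branch_frac (P i)}.
Hypothesis normP : forall i, normalization (phi i).
Local Notation W := {ffun 'I_r -> mpseries 1 k}.

Lemma to_branch_eq0 i x : (to_branch (P i) x == 0) = (x \in P i).
Proof.
by rewrite -(rmorph0 (to_branch (P i))) -[x in RHS]subr0 Quotient.idealrBE; apply/eqP/eqP.
Qed.

(** The elements of the branch are integral over it, and [phi i] is injective. *)
Lemma branch_series i :
  exists rho : {lrmorphism O -> mpseries 1 k},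
    forall x, phi i (rho x) = to_branch_frac (P i) x.
Proof.
have [phi_inj phiZ phi_int] := normP i.
have /boolp.choice[rho rhoE] x : exists g, phi i g = to_branch_frac (P i) x.
  by apply/phi_int; apply: integral_id.
have rho_lin : linear rho.
  move=> c x y; apply: phi_inj.
  rewrite rhoE rmorphD -[c *: rho x]mulr_algl rmorphM /= phiZ !rhoE.
  by rewrite -[c *: x]mulr_algl /to_branch_frac !(rmorphD, rmorphM).
have rho_mon : monoid_morphism rho.
  split=> [|x y]; apply: phi_inj; first by rewrite rhoE rmorph1 /to_branch_frac !rmorph1.
  by rewrite rmorphM !rhoE /to_branch_frac !rmorphM.
pose rhoL := GRing.isLinear.Build _ _ _ _ rho rho_lin.
pose rhoM := GRing.isMonoidMorphism.Build _ _ rho rho_mon.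
pose R : {lrmorphism O -> mpseries 1 k} := HB.pack rho rhoL rhoM.
by exists R.
Qed.

Lemma series_embedding :
  exists Phi : {linear W -> totfrac P}, forall w i, Phi w i = phi i (w i).
Proof.
pose F (w : W) : totfrac P := fun i => phi i (w i).
have F_lin : linear F.
  move=> c v w; apply: functional_extensionality_dep => i.
  have [_ phiZ _] := normP i.
  rewrite /F !ffunE rmorphD -mulr_algl rmorphM /= phiZ.
  by [].
pose FL := GRing.isLinear.Build _ _ _ _ F F_lin.
pose Phi : {linear W -> totfrac P} := HB.pack F FL.
by exists Phi.
Qed.

Lemma to_branch_onto i (b : branch (P i)) : exists x, to_branch (P i) x = b.
Proof. by exists (repr b); rewrite /to_branch reprK. Qed.

Lemma tf_eval (p : {poly O}) (h : totfrac P) i :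
  (\sum_(j < size p) to_totfrac P p`_j * h ^+ j) i =
  (map_poly (fun x => to_branch_frac (P i) x) p).[h i].
Proof.
have expE j : (h ^+ j) i = h i ^+ j.
  by elim: j => // j IH; rewrite !exprS -IH.
have sumE (s : seq 'I_(size p)) (F : 'I_(size p) -> totfrac P) :
    (\sum_(j <- s) F j) i = \sum_(j <- s) F j i.
  by elim: s => [|j s IH]; rewrite ?big_nil // !big_cons -IH.
rewrite sumE /map_poly horner_poly; apply: eq_bigr => j _.
by rewrite -expE.
Qed.

Lemma to_branch_frac_poly i (p : {poly O}) :
  map_poly (fun x => to_branch_frac (P i) x) p =
  map_poly (@FracField.tofrac (branch (P i))) (map_poly (to_branch (P i)) p).
Proof. by rewrite -map_poly_comp. Qed.

Lemma monic_lift i (q : {poly branch (P i)}) : q \is monic ->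
  exists2 p : {poly O}, p \is monic & map_poly (to_branch (P i)) p = q.
Proof.
move=> qm; have /boolp.choice[g gE] := @to_branch_onto i.
have szq : size q = (size q).-1.+1 by rewrite prednK // size_poly_gt0 monic_neq0.
exists ('X^((size q).-1) + \poly_(j < (size q).-1) g q`_j).
  rewrite monicE lead_coefDl ?lead_coefXn // size_polyXn ltnS.
  exact: size_poly.
rewrite rmorphD /= map_polyXn; apply/polyP => j.
rewrite coefD coefXn coef_map coef_poly /=.
case: ltngtP => [jq|jq|->].
- by rewrite gE add0r.
- by rewrite (rmorph0 (to_branch (P i))) addr0 nth_default // szq.
- by rewrite (rmorph0 (to_branch (P i))) addr0; move/monicP: qm.
Qed.

(** A family of monic equations, one for each branch, lifts to the ring, and the product
    of the lifts annihilates all the components at once. *)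
Lemma integral_closureE h :
  integral_closure P h <-> forall i, exists u, phi i u = h i.
Proof.
split=> [[p pm /(congr1 (fun h => h _)) pE] i|hphi].
  have [_ _ phi_int] := normP i; apply/phi_int.
  exists (map_poly (to_branch (P i)) p); first exact: monic_map.
  by rewrite -to_branch_frac_poly /root -tf_eval pE.
have /boolp.choice[p pP] i : exists p : {poly O}, p \is monic /\
    root (map_poly (fun x => to_branch_frac (P i) x) p) (h i).
  have [_ _ phi_int] := normP i.
  have [q /monic_lift[p pm <-] qh] := (phi_int _).2 (hphi i).
  by exists p; rewrite to_branch_frac_poly.
exists (\prod_i p i); first by apply: monic_prod => i _; case: (pP i).
apply: functional_extensionality_dep => i; rewrite tf_eval to_branch_frac_poly.
rewrite (bigD1 i) //= !rmorphM /= hornerM -to_branch_frac_poly.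
by case: (pP i) => _ /rootP->; rewrite mul0r.
Qed.

Hypothesis minP : minimal_primes P.

(** Distinct minimal primes are incomparable; multiply elements of the other P j outside
    P i. *)
Lemma separating_element i : exists2 x, x \notin P i & forall j, j != i -> x \in P j.
Proof.
have [mP injP _] := minP.
have /boolp.choice[x xP] j : exists x, j != i -> x \in P j /\ x \notin P i.
  have [->|ji] := eqVneq j i; first by exists 0.
  have : ~ {subset P j <= P i}.
    move=> PjPi; move/eqP: ji; apply; apply: injP => x.
    by apply/idP/idP; [exact: PjPi|exact: mP PjPi x].
  by move=> /existsNP[x /not_implyP[xj /negP xi]]; exists x.
exists (\prod_(j | j != i) x j).
  elim/big_ind: _ => [|y z yi zi|j /xP[]//]; first by rewrite idealr1.
  by rewrite prime_idealrM negb_or yi.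
move=> j ji; rewrite (bigD1 j) //= mulrC; apply: idealMr.
by case: (xP j ji).
Qed.

Variables (n : nat) (f : {lrmorphism mpseries n k -> O}).
Hypothesis f_onto : forall y, exists x, f x = y.
Variable rho : 'I_r -> {lrmorphism O -> mpseries 1 k}.
Hypothesis rhoE : forall i x, phi i (rho i x) = to_branch_frac (P i) x.

Lemma phi_inj i : injective (phi i). Proof. by case: (normP i). Qed.

Lemma rho_eq0 i x : rho i x = 0 <-> x \in P i.
Proof.
rewrite -to_branch_eq0 -[to_branch _ _ == 0]tofrac_eq0.
split=> [x0|/eqP x0]; last by apply: (@phi_inj i); rewrite rhoE rmorph0.
by have := rhoE i x; rewrite x0 rmorph0 => /esym/eqP.
Qed.

Definition curve_image : set W := [set w | exists x, forall i, w i = rho i x].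

Lemma curve_image_only i : exists N, forall u, vanish u N -> curve_image (only i u).
Proof.
have fracP j u : exists a b, (rho j \o f) b <> 0 /\ (rho j \o f) b * u = (rho j \o f) a.
  have [p [q [q0 pq]]] := fraction_numden (phi j u).
  have [x xp] := to_branch_onto p; have [y yq] := to_branch_onto q.
  have [a fa] := f_onto x; have [b fb] := f_onto y.
  exists a, b; rewrite /= fa fb; split.
    by rewrite rho_eq0 -to_branch_eq0 yq; apply/negP.
  apply: (@phi_inj j); rewrite rmorphM !rhoE /to_branch_frac xp yq -pq.
  by rewrite mulrC.
have sepP j : exists2 z, (rho j \o f) z <> 0 & forall l, l != j -> (rho l \o f) z = 0.
  have [x xj xl] := separating_element j; have [z fz] := f_onto x.
  exists z => [|l lj]; rewrite /= fz rho_eq0; first exact/negP.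
  exact: xl.
have [N NP] := branches_conductor (psi := fun j => rho j \o f) fracP sepP i.
exists N => u /NP[s si sj]; exists (f s) => j; rewrite ffunE.
by case: eqP => [->|/eqP/sj].
Qed.

Lemma curve_image_subspace : subspace curve_image.
Proof.
split=> [|c v w [x vx] [y wy]]; first by exists 0 => i; rewrite ffunE rmorph0.
by exists (c *: x + y) => i; rewrite !ffunE vx wy linearP.
Qed.

Lemma curve_image1 : curve_image 1.
Proof. by exists 1 => i; rewrite ffunE rmorph1. Qed.

Lemma curve_imageM v w : curve_image v -> curve_image w -> curve_image (v * w).
Proof. by move=> [x vx] [y wy]; exists (x * y) => i; rewrite ffunE vx wy rmorphM. Qed.

Lemma curve_image_local w : curve_image w -> forall i j, tcoef (w i) 0 = tcoef (w j) 0.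
Proof.
move=> [x wx] i j; have [y fy] := f_onto x.
by rewrite !wx -fy !(lrmorph_const (rho _ \o f)).
Qed.

Lemma value_semigroupE : value_semigroup phi = value_set curve_image.
Proof.
apply/seteqP; split=> z.
  move=> [x zx]; have /boolp.choice[b bP] i : exists b, has_order (rho i x) b /\ z i = b%:Z.
    have := zx i; rewrite /to_totfrac -rhoE.
    by move=> /(value_eqE _ _ (@phi_inj i))[b]; exists b.
  exists b; last by apply/ffunP => i; rewrite ffunE; case: (bP i).
  exists [ffun i => rho i x]; split=> [|i]; last by rewrite ffunE; case: (bP i).
  by exists x => i; rewrite ffunE.
move=> [b [w [[x wx] wb]] ->]; exists x => i; rewrite /to_totfrac -rhoE.
by apply/(value_eqE _ _ (@phi_inj i)); exists (b i); rewrite -?wx ?ffunE.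
Qed.

Lemma gorensteinE (c : 'I_r -> nat) :
    [set w | forall x, curve_image (w * x)] = wge c ->
  gorenstein P <-> gorenstein_balance curve_image c.
Proof.
move=> condE; have [Phi PhiE] := series_embedding.
have Phi_inj : injective Phi.
  by move=> v w vw; apply/ffunP => i; apply: (@phi_inj i); rewrite -!PhiE vw.
have PhiM v w : Phi (v * w) = Phi v * Phi w.
  by apply: functional_extensionality_dep => i; rewrite PhiE ffunE rmorphM -!PhiE.
have imE : image_ring P = Phi @` curve_image.
  apply/seteqP; split=> h.
    move=> [x _ <-]; exists [ffun i => rho i x]; first by exists x => i; rewrite ffunE.
    by apply: functional_extensionality_dep => i; rewrite PhiE ffunE rhoE.
  move=> [w [x wx] <-]; exists x => //.
  by apply: functional_extensionality_dep => i; rewrite PhiE wx rhoE.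
have intE : integral_closure P = Phi @` setT.
  apply/seteqP; split=> h.
    move=> /integral_closureE/boolp.choice[u uh]; exists [ffun i => u i] => //.
    by apply: functional_extensionality_dep => i; rewrite PhiE ffunE uh.
  by move=> [w _ <-]; apply/integral_closureE => i; exists (w i); rewrite PhiE.
have inA w : image_ring P (Phi w) <-> curve_image w.
  by rewrite imE; split=> [[v Av /Phi_inj <-]|Aw]; [|exists w].
have condPE : conductor_ideal P = Phi @` wge c.
  rewrite -condE; apply/seteqP; split=> h.
    move=> hC; have hI w : image_ring P (h * Phi w) by apply: hC; rewrite intE; exists w.
    have Phi1 : Phi 1 = 1.
      by apply: functional_extensionality_dep => i; rewrite PhiE ffunE rmorph1.
    have := hI 1; rewrite Phi1 mulr1 imE => -[w Aw wh].
    exists w => // x; apply/inA; rewrite PhiM wh; exact: hI.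
  by move=> [w wC <-] g; rewrite intE => -[x _ <-]; rewrite -PhiM; apply/inA.
rewrite /gorenstein /gorenstein_balance imE intE condPE.
by split=> -[d [dA dO]]; exists d; move: dA dO; rewrite !(quot_dim_image _ _ _ Phi_inj).
Qed.

End Curve.

Theorem theorem16 (k : closedFieldType) (O : comAlgType k) (r : nat)
    (P : 'I_r -> prime_idealr O)
    (phi : forall i, {rmorphism mpseries 1 k -> branch_frac (P i)})
    (alpha : {ffun 'I_r -> int}) :
  algebroid_curve O ->
  minimal_primes P ->
  (forall i, normalization (phi i)) ->
  let S := value_semigroup phi in
  S alpha -> alpha <> 0 ->
  (gorenstein P <-> symmetric_semigroup S) /\
  (symmetric_semigroup S <->
   forall a, natural a -> apery S alpha a ->
     FS S (frobenius S + alpha - a) <> set0 /\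
     FS S (frobenius S + alpha - a) `<=` apery S alpha).
Proof.
move=> [[n [f f_onto]] _ _] minP normP S.
have /boolp.choice[rho rhoE] i := branch_series normP i.
have {S}-> : S = value_set (curve_image rho) := value_semigroupE normP rhoE.
set A := curve_image rho => Sal al0.
have sA : subspace A := curve_image_subspace rho.
have A1 : A 1 := curve_image1 rho.
have AM := @curve_imageM _ _ _ rho.
have onlyA := curve_image_only normP minP f_onto rhoE.
have [c [cA cmin]] := least_conductor sA onlyA.
split.
  rewrite (gorensteinE normP rhoE (conductor_idealE sA cA cmin)).
  rewrite (gorenstein_symmetric_values sA AM cA cmin).
  by rewrite (symmetric_value_set sA cA cmin).
apply: symmetric_apery => //.
- exact: value_set_natural.
- exact: value_setD.
- by move=> a; rewrite (conductor_value_set sA cA cmin); apply: value_set_conductor.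
- exact: (FS_frobenius_value_set sA A1 AM cA cmin).
- exact: (value_set_positive (@curve_image_local _ _ _ _ f f_onto rho) Sal al0).
Qed.
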